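(* Let $q\geq 3$ be odd. For each reduced fraction $(v,w)$ with $v/w\in\Gamma_q.\infty\cap(0,1]$, \[ \operatorname*{w^*\text{-}lim}_{n\to\infty}\; c_{v/w}\,vw\,\log(n)\sum_{(r,s)\in \mathrm{RF}_{q,n}(v,w)}\frac{1}{s^2}\,\delta_{r/s}=m, \] where $c_1=2$ and $c_y=1$ for $y\neq 1$. (Weak-star convergence means convergence of integrals against every continuous function on $[0,1]$.)
   Context: Setup. Let $q\geq 3$ be odd and $\lambda=\lambda_q=2\cos(\pi/q)$. Elements of $\mathrm{PGL}_2(\mathbb{R})$ are written as matrices (a matrix and its nonzero scalar multiples represent the same element); they act on $\mathbb{R}\cup\{\infty\}$ by $x\mapsto (ax+b)/(cx+d)$, written $g.x$. The Hecke triangle group $\Gamma_q\subset\mathrm{PSL}_2(\mathbb{R})$ is generated by $T=\begin{bmatrix}1&\lambda\\0&1\end{bmatrix}$ and $S=\begin{bmatrix}0&1\\-1&0\end{bmatrix}$. Put $s(x)=\sin(x\pi/q)/\sin(\pi/q)$, $g_k=\begin{bmatrix}s(k)&-s(k+1)\\-s(k-1)&s(k)\end{bmatrix}\in\Gamma_q$, $Q=\begin{bmatrix}0&1\\1&0\end{bmatrix}$, $K=\{(q+1)/2,\dots,q-1\}$. The generalized Farey map $F_q\colon[0,1]\to[0,1]$ is defined, for $k\in K$, by $F_q(x)=g_k.x$ on $[g_k^{-1}.0,g_k^{-1}.1]$ and $F_q(x)=Qg_k.x$ on $[(Qg_k)^{-1}.1,(Qg_k)^{-1}.0]$. A pair $(a,c)\in\mathbb{Z}[\lambda]^2$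 is a reduced fraction if some element of $\Gamma_q$ has a representing matrix of determinant $1$ of the form $\begin{bmatrix}a&*\\c&*\end{bmatrix}$; $(a,c)$ and $(-a,-c)$ are identified, and the class is identified with $a/c\in\mathbb{R}\cup\{\infty\}$ (each point of $\Gamma_q.\infty$ has a unique such representation). For a reduced fraction $(v,w)$ with $v/w\in\Gamma_q.\infty\cap[0,1]$, $\mathrm{RF}_{q,n}(v,w)$ is the set of reduced fractions $(r,s)$ with $r/s\in F_q^{-n}(v/w)$. $m$ is Lebesgue measure on $[0,1]$; $\delta_y$ is the Dirac measure at $y$. *)

(* Defs.v *)
From Stdlib Require Import Reals List Arith.
From Coquelicot Require Import Coquelicot.
Open Scope R_scope.

Record mat := Mat { m11 : R; m12 : R; m21 : R; m22 : R }.

Definition mmul (A B : mat) : mat :=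
  Mat (m11 A * m11 B + m12 A * m21 B) (m11 A * m12 B + m12 A * m22 B)
      (m21 A * m11 B + m22 A * m21 B) (m21 A * m12 B + m22 A * m22 B).

Definition mdet (A : mat) : R := m11 A * m22 A - m12 A * m21 A.

(* a matrix inverse up to scalar (adjugate): represents the inverse in PGL_2(R) *)
Definition madj (A : mat) : mat := Mat (m22 A) (- m12 A) (- m21 A) (m11 A).

Definition mob (A : mat) (x : R) : R := (m11 A * x + m12 A) / (m21 A * x + m22 A).

Definition mI : mat := Mat 1 0 0 1.

Definition lam (q : nat) : R := 2 * cos (PI / INR q).

Definition matT (q : nat) : mat := Mat 1 (lam q) 0 1.
Definition matTinv (q : nat) : mat := Mat 1 (- lam q) 0 1.
Definition matS : mat := Mat 0 1 (-1) 0.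
Definition matQ : mat := Mat 0 1 1 0.

(* The preimage of the Hecke group Gamma_q in SL_2(R): the group generated by
   T and S (it contains -I = S^2, and S^{-1} = S^3). *)
Inductive hecke (q : nat) : mat -> Prop :=
| hecke_I : hecke q mI
| hecke_T : forall M, hecke q M -> hecke q (mmul (matT q) M)
| hecke_Tinv : forall M, hecke q M -> hecke q (mmul (matTinv q) M)
| hecke_S : forall M, hecke q M -> hecke q (mmul matS M).

Definition Zlam (q : nat) (x : R) : Prop :=
  exists l : list Z,
    x = fold_right (fun a acc => IZR a + lam q * acc) 0 l.

Definition reduced (q : nat) (a c : R) : Prop :=
  Zlam q a /\ Zlam q c /\
  exists M, hecke q M /\ mdet M = 1 /\ m11 M = a /\ m21 M = c.

Definition sq (q : nat) (x : R) : R := sin (x * PI / INR q) / sin (PI / INR q).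

Definition gk (q k : nat) : mat :=
  Mat (sq q (INR k)) (- sq q (INR k + 1)) (- sq q (INR k - 1)) (sq q (INR k)).

Definition inK (q k : nat) : Prop := ((q + 1) / 2 <= k <= q - 1)%nat.

(* The generalized Farey map F_q, as its graph: F_q(x) = y. *)
Definition Frel (q : nat) (x y : R) : Prop :=
  0 <= x <= 1 /\
  exists k, inK q k /\
   ((mob (madj (gk q k)) 0 <= x <= mob (madj (gk q k)) 1 /\ y = mob (gk q k) x) \/
    (mob (madj (mmul matQ (gk q k))) 1 <= x <= mob (madj (mmul matQ (gk q k))) 0 /\
     y = mob (mmul matQ (gk q k)) x)).

Fixpoint Fpre (q : nat) (n : nat) (y x : R) : Prop :=
  match n with
  | O => x = y
  | S n' => exists z, Frel q x z /\ Fpre q n' y z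
  end.

(* (r,s) \in RF_{q,n}(v,w)  (s <> 0 since r/s lies in [0,1], not at infinity) *)
Definition RF (q n : nat) (v w r s : R) : Prop :=
  reduced q r s /\ s <> 0 /\ Fpre q n (v / w) (r / s).

Definition cconst (y : R) : R := if Req_EM_T y 1 then 2 else 1.

Definition cont01 (f : R -> R) : Prop :=
  forall x, 0 <= x <= 1 ->
    filterlim f (within (fun y => 0 <= y <= 1) (locally x)) (locally (f x)).

Definition sum_list (l : list R) : R := fold_right Rplus 0 l.

(* Main.v *)
Require Import Defs.
From Stdlib Require Import Reals List Arith Lra Lia ClassicalEpsilon FunctionalExtensionality.
From Coquelicot Require Import Coquelicot.
Open Scope R_scope.

(** With y = v/w, the sum over the n-th preimages is w^-2 (P^n f)(y), halved for
    y = 1, where P is the transfer operator of the generalized Farey map: an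
    element of the group with bottom row (c, d) has derivative (cy + d)^-2 at y
    up to sign, and cv + dw is the denominator of the image fraction.  So one
    has to show y log(n) (P^n f)(y) -> int f.

    Put phi_n(y) = y (P^n f)(y).  As dx/x is invariant, phi_n evolves by a Markov
    operator with weights summing to 1.  This operator preserves the cone of
    increasing concave functions: partial sums of the weights over the
    lowest cells are convex, each product (weight)(branch) is concave, and the
    two families of branches cancel to first order at y = 1.  For f in the cone,
    a_n = phi_n(1) = max phi_n is decreasing.  The parabolic branch at 0 has the
    iterates y/(1 + k lambda y), taken with probability 1/(1 + k lambda y), which
    gives phi_n(y) >= (1 - 1/(1 + n lambda y)) a_n - O(y).  Both bounds on phi_n,
    inserted in the conservation law int phi_n(y) dy/y = int f on the range
    1/n < y < 1, give a_n log n -> int f, and phi_n(y)/a_n -> 1 follows at fixed y.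
    Piecewise linear interpolation of x f(x), a combination of the functions
    min(x, c) of the cone, reaches every continuous f. *)

(** * The transfer operator as a Markov operator *)

(** The measure [dx/x] has infinite mass, so [phi_n] tends to 0 and what matters is its rate.
    Concavity and monotonicity put the maximum at 1 at every time, so that one decreasing sequence
    [a_n] controls the whole profile.

    The cone is preserved for this reason. Bound [x f(x)] by its supporting line at each inverse
    image of [y0]. The slopes multiply the concave products (weight)(branch); the intercepts
    multiply the weights, which need not be concave one by one. But intercepts of a concave function
    grow from left to right, so summation by parts needs only convexity of the cumulative weights.
    The total weight is constant because q is odd: s(m+2) = s(m+1).

    The O(y) error does not accumulate in n: what the other branches lose in one step is at most a
    constant times y (a_n - a_(n+1)), which telescopes.

    Passing from sets of fractions to the operator requires that a point have only one reduced
    fraction with positive denominator. This is read off from a description of the orbit of (1, 0)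
    by cells of the first quadrant. *)

Lemma Rle_div_r_intro a b c : 0 < c -> a * c <= b -> a <= b / c.
Proof. intros Hc. apply Rle_div_r; assumption. Qed.

Lemma Rle_div_l_intro a b c : 0 < c -> a <= b * c -> a / c <= b.
Proof. intros Hc. apply Rle_div_l; assumption. Qed.

(* [sg i] stands for s(i) = s(q - i) and [la] for lambda, with q = 2m + 3.  An
   index [i <= m] encodes k = q - 1 - i in K, so that s(k-1), s(k), s(k+1) are
   [sg (i+2)], [sg (i+1)], [sg i]; below, [zl i] and [zr i] are the inverse
   branches g_k^-1 and (Q g_k)^-1. *)
Record ladder (la : R) (sg : nat -> R) (m : nat) : Prop := {
  ladder_la : 1 <= la < 2;
  ladder_0 : sg 0%nat = 0;
  ladder_1 : sg 1%nat = 1;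
  ladder_rec : forall i, sg (S (S i)) = la * sg (S i) - sg i;
  ladder_mono : forall i, (i <= m)%nat -> sg i <= sg (S i);
  ladder_top : sg (S (S m)) = sg (S m) }.

Definition dl (sg : nat -> R) i y := sg (S (S i)) * y + sg (S i).
Definition dr (sg : nat -> R) i y := sg (S i) * y + sg (S (S i)).
Definition zl (sg : nat -> R) i y := (sg (S i) * y + sg i) / dl sg i y.
Definition zr (sg : nat -> R) i y := (sg i * y + sg (S i)) / dr sg i y.

Definition transfer (sg : nat -> R) (m : nat) (f : R -> R) (y : R) : R :=
  sum_f_R0 (fun i => f (zl sg i y) / dl sg i y ^ 2 + f (zr sg i y) / dr sg i y ^ 2) m.

(* The weights of the Markov operator [phi |-> x * transfer (phi / x)], written
   as differences of consecutive cumulative weights; for [i = 0] the subtracted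
   term is [0 / _ = 0]. *)
Definition pl (sg : nat -> R) i y := sg (S i) / dl sg i y - sg i / (sg (S i) * y + sg i).
Definition pr (sg : nat -> R) i y := sg (S i) * y / dr sg i y - sg i * y / (sg i * y + sg (S i)).

Section Ladder.

Context {la : R} {sg : nat -> R} {m : nat} (H : ladder la sg m).

(** The recurrence leaves this expression invariant. It is the determinant of [g_k], so the inverse
    branches have derivatives [1 / dl^2] and [- 1 / dr^2]. *)
Lemma ladder_det i : sg (S i) ^ 2 - sg i * sg (S (S i)) = 1.
Proof.
induction i as [|i IH].
- rewrite (ladder_0 _ _ _ H), (ladder_1 _ _ _ H). ring.
- rewrite (ladder_rec _ _ _ H (S i)).
  transitivity (sg (S (S i)) * (sg (S (S i)) - la * sg (S i)) + sg (S i) ^ 2); [ring|].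
  rewrite <- IH, (ladder_rec _ _ _ H i). ring.
Qed.

Lemma ladder_ge1 i : (i <= S m)%nat -> 1 <= sg (S i).
Proof.
induction i as [|i IH]; intros Hi.
- rewrite (ladder_1 _ _ _ H). lra.
- specialize (IH ltac:(lia)). destruct (Nat.eq_dec i m) as [->|Hn].
  + rewrite (ladder_top _ _ _ H). lra.
  + pose proof (ladder_mono _ _ _ H (S i) ltac:(lia)). lra.
Qed.

Lemma ladder_ge0 i : (i <= S m)%nat -> 0 <= sg i.
Proof.
destruct i as [|i]; intros Hi.
- rewrite (ladder_0 _ _ _ H). lra.
- pose proof (ladder_ge1 i ltac:(lia)). lra.
Qed.

(** The last bound comes from [la < 2]; it is the condition under which [y / dl^2] is concave on
    [0, 1]. *)
Lemma ladder_step i : (i <= m)%nat ->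
  0 <= sg i /\ 1 <= sg (S i) /\ sg i <= sg (S i) /\ sg (S i) <= sg (S (S i)) /\
  sg (S (S i)) <= 2 * sg (S i).
Proof.
intros Hi.
pose proof (ladder_ge0 i ltac:(lia)). pose proof (ladder_ge1 i ltac:(lia)).
pose proof (ladder_mono _ _ _ H i Hi). pose proof (ladder_la _ _ _ H).
assert (sg (S i) <= sg (S (S i))).
{ destruct (Nat.eq_dec i m) as [->|Hn].
  - rewrite (ladder_top _ _ _ H). lra.
  - apply (ladder_mono _ _ _ H). lia. }
repeat split; try lra.
rewrite (ladder_rec _ _ _ H). nra.
Qed.

Lemma dl_pos i y : (i <= m)%nat -> 0 <= y -> 0 < dl sg i y.
Proof. intros Hi Hy. pose proof (ladder_step i Hi). unfold dl. nra. Qed.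

Lemma dr_pos i y : (i <= m)%nat -> 0 <= y -> 0 < dr sg i y.
Proof. intros Hi Hy. pose proof (ladder_step i Hi). unfold dr. nra. Qed.

Lemma zl_bounds i y : (i <= m)%nat -> 0 <= y <= 1 -> 0 <= zl sg i y <= 1.
Proof.
intros Hi Hy. pose proof (ladder_step i Hi). pose proof (dl_pos i y Hi ltac:(lra)).
unfold zl. split.
- apply Rle_div_r_intro; [lra|]. nra.
- apply Rle_div_l_intro; [lra|]. unfold dl. nra.
Qed.

Lemma zr_bounds i y : (i <= m)%nat -> 0 <= y <= 1 -> 0 < zr sg i y <= 1.
Proof.
intros Hi Hy. pose proof (ladder_step i Hi). pose proof (dr_pos i y Hi ltac:(lra)).
unfold zr. split.
- apply Rdiv_lt_0_compat; nra.
- apply Rle_div_l_intro; [lra|]. unfold dr. nra.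
Qed.

Lemma zl_pos i y : (i <= m)%nat -> 0 < y <= 1 -> 0 < zl sg i y.
Proof.
intros Hi Hy. pose proof (ladder_step i Hi). pose proof (dl_pos i y Hi ltac:(lra)).
unfold zl. apply Rdiv_lt_0_compat; nra.
Qed.

(** Together with [zr_le_zl_S] this orders the inverse images as [zl 0], [zr 0], [zl 1], [zr 1],
    ..., the order in which the weights are accumulated. *)
Lemma zl_le_zr i y : (i <= m)%nat -> 0 <= y <= 1 -> zl sg i y <= zr sg i y.
Proof.
intros Hi Hy. pose proof (ladder_step i Hi). pose proof (ladder_det i) as Hd.
pose proof (dl_pos i y Hi ltac:(lra)). pose proof (dr_pos i y Hi ltac:(lra)).
unfold zl, zr. apply Rle_div_l_intro; [lra|].
replace ((sg i * y + sg (S i)) / dr sg i y * dl sg i y)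
  with ((sg i * y + sg (S i)) * dl sg i y / dr sg i y) by (field; lra).
apply Rle_div_r_intro; [lra|].
apply Rminus_le.
replace (_ - _) with ((sg (S i) ^ 2 - sg i * sg (S (S i))) * (y ^ 2 - 1)) by (unfold dl, dr; ring).
rewrite Hd. nra.
Qed.

Lemma zr_le_zl_S i y : (S i <= m)%nat -> 0 <= y <= 1 -> zr sg i y <= zl sg (S i) y.
Proof.
intros Hi Hy.
pose proof (ladder_step i ltac:(lia)). pose proof (ladder_step (S i) Hi).
pose proof (ladder_det i) as Hd. pose proof (ladder_det (S i)) as Hd'.
pose proof (dl_pos (S i) y Hi ltac:(lra)). pose proof (dr_pos i y ltac:(lia) ltac:(lra)).
(* [zr i y <= B/A <= zl (S i) y] with [B/A] the common end of the two cells *)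
transitivity (sg (S i) / sg (S (S i))).
- unfold zr. apply Rle_div_l_intro; [lra|].
  replace (_ / _ * _) with (sg (S i) * dr sg i y / sg (S (S i))) by (field; lra).
  apply Rle_div_r_intro; [lra|]. apply Rminus_le.
  replace (_ - _) with (- (sg (S i) ^ 2 - sg i * sg (S (S i))) * y) by (unfold dr; ring).
  rewrite Hd. lra.
- unfold zl. apply Rle_div_r_intro; [lra|].
  replace (_ / _ * _) with (sg (S i) * dl sg (S i) y / sg (S (S i))) by (field; lra).
  apply Rle_div_l_intro; [lra|]. apply Rminus_le.
  replace (_ - _) with (- (sg (S (S i)) ^ 2 - sg (S i) * sg (S (S (S i)))) * y) by (unfold dl; ring).
  rewrite Hd'. lra.
Qed.

Lemma pl_eq i y : (i <= m)%nat -> 0 < y ->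
  pl sg i y = y / ((sg (S i) * y + sg i) * dl sg i y).
Proof.
intros Hi Hy. pose proof (ladder_step i Hi). pose proof (ladder_det i) as Hd.
pose proof (dl_pos i y Hi ltac:(lra)). assert (0 < sg (S i) * y + sg i) by nra.
unfold pl.
transitivity (y * (sg (S i) ^ 2 - sg i * sg (S (S i))) / ((sg (S i) * y + sg i) * dl sg i y)).
- unfold dl in *. field. lra.
- rewrite Hd. f_equal. ring.
Qed.

Lemma pr_eq i y : (i <= m)%nat -> 0 <= y ->
  pr sg i y = y / ((sg i * y + sg (S i)) * dr sg i y).
Proof.
intros Hi Hy. pose proof (ladder_step i Hi). pose proof (ladder_det i) as Hd.
pose proof (dr_pos i y Hi ltac:(lra)). assert (0 < sg i * y + sg (S i)) by nra.
unfold pr.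
transitivity (y * (sg (S i) ^ 2 - sg i * sg (S (S i))) / ((sg i * y + sg (S i)) * dr sg i y)).
- unfold dr in *. field. lra.
- rewrite Hd. f_equal. ring.
Qed.

Lemma pl_at0 i : (i <= m)%nat -> pl sg i 0 = match i with O => 1 | _ => 0 end.
Proof.
intros Hi. unfold pl, dl. destruct i as [|i].
- rewrite (ladder_0 _ _ _ H), (ladder_1 _ _ _ H). unfold Rdiv.
  rewrite Rmult_0_r, Rplus_0_l, Rmult_0_l. field.
- pose proof (ladder_step (S i) Hi). pose proof (ladder_ge1 i ltac:(lia)).
  field_simplify; lra.
Qed.

Lemma pl_ge0 i y : (i <= m)%nat -> 0 <= y -> 0 <= pl sg i y.
Proof.
intros Hi [Hy|<-].
- rewrite pl_eq by assumption. pose proof (ladder_step i Hi).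
  pose proof (dl_pos i y Hi ltac:(lra)). apply Rlt_le, Rdiv_lt_0_compat; [lra|].
  apply Rmult_lt_0_compat; nra.
- rewrite pl_at0 by assumption. destruct i; lra.
Qed.

Lemma pr_ge0 i y : (i <= m)%nat -> 0 <= y -> 0 <= pr sg i y.
Proof.
intros Hi Hy. rewrite pr_eq by assumption. pose proof (ladder_step i Hi).
pose proof (dr_pos i y Hi ltac:(lra)). apply Rdiv_le_0_compat; [lra|].
apply Rmult_lt_0_compat; nra.
Qed.

(** Turns [y / d^2 * f z] into weight times [z * f z], so that [y * transfer f y] is an average of
    [x * f x] over the inverse images. At [y = 0] the first weight is 1, but its branch has value
    0. *)
Lemma weight_l i y : (i <= m)%nat -> 0 <= y -> y / dl sg i y ^ 2 = pl sg i y * zl sg i y.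
Proof.
intros Hi [Hy|<-].
- rewrite pl_eq by assumption. pose proof (ladder_step i Hi).
  pose proof (dl_pos i y Hi ltac:(lra)). assert (0 < sg (S i) * y + sg i) by nra.
  unfold zl. field. lra.
- rewrite pl_at0 by assumption. unfold zl. destruct i.
  + rewrite (ladder_0 _ _ _ H), Rmult_0_r. unfold Rdiv. ring.
  + unfold Rdiv. ring.
Qed.

Lemma weight_r i y : (i <= m)%nat -> 0 <= y -> y / dr sg i y ^ 2 = pr sg i y * zr sg i y.
Proof.
intros Hi Hy.
rewrite pr_eq by assumption. pose proof (ladder_step i Hi).
pose proof (dr_pos i y Hi ltac:(lra)). assert (0 < sg i * y + sg (S i)) by nra.
unfold zr. field. lra.
Qed.

Lemma transfer_markov f y : 0 <= y ->
  y * transfer sg m f y =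
  sum_f_R0 (fun i => pl sg i y * (zl sg i y * f (zl sg i y))
                   + pr sg i y * (zr sg i y * f (zr sg i y))) m.
Proof.
intros Hy. unfold transfer. rewrite scal_sum. apply sum_eq. intros i Hi.
rewrite <- !Rmult_assoc, <- weight_l, <- weight_r by assumption.
unfold Rdiv. ring.
Qed.

(** The sum telescopes: the terms subtracted at index [i + 1] have the denominators [dl i] and
    [dr i]. *)
Lemma sum_weights n y : (n <= m)%nat -> 0 <= y ->
  sum_f_R0 (fun i => pl sg i y + pr sg i y) n = sg (S n) / dl sg n y + sg (S n) * y / dr sg n y.
Proof.
intros Hn Hy. induction n as [|n IH].
- simpl. unfold pl, pr. rewrite (ladder_0 _ _ _ H). unfold Rdiv. ring.
- rewrite tech5, IH by lia. unfold pl, pr, dl, dr. ring.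
Qed.

Lemma sum_weights_1 y : 0 <= y -> sum_f_R0 (fun i => pl sg i y + pr sg i y) m = 1.
Proof.
intros Hy. rewrite sum_weights by (auto with arith).
pose proof (ladder_step m (le_n m)). unfold dl, dr. rewrite (ladder_top _ _ _ H).
field. apply Rgt_not_eq. nra.
Qed.

Lemma transfer_markov_minus f y c : 0 <= y ->
  y * transfer sg m f y - c =
  sum_f_R0 (fun i => pl sg i y * (zl sg i y * f (zl sg i y) - c)
                   + pr sg i y * (zr sg i y * f (zr sg i y) - c)) m.
Proof.
intros Hy. rewrite transfer_markov by assumption.
transitivity (sum_f_R0 (fun i => pl sg i y * (zl sg i y * f (zl sg i y))
                   + pr sg i y * (zr sg i y * f (zr sg i y))) m
  - c * sum_f_R0 (fun i => pl sg i y + pr sg i y) m).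
- rewrite sum_weights_1 by assumption. ring.
- rewrite scal_sum, <- minus_sum. apply sum_eq. intros i Hi. ring.
Qed.

End Ladder.

(** * Invariance of the concave cone *)

(* Deviations of the cumulative weights [B / (A y + B)] and [B y / (B y + A)] from
   their tangent lines at [y0]. *)
Definition gap_l A B y y0 :=
  B / (A * y + B) - B / (A * y0 + B) + A * B / (A * y0 + B) ^ 2 * (y - y0).
Definition gap_r A B y y0 :=
  B * y / (B * y + A) - B * y0 / (B * y0 + A) - A * B / (B * y0 + A) ^ 2 * (y - y0).

Lemma gap_l_eq A B y y0 : 0 < A * y + B -> 0 < A * y0 + B ->
  gap_l A B y y0 = A ^ 2 * B * (y - y0) ^ 2 / ((A * y + B) * (A * y0 + B) ^ 2).
Proof. intros. unfold gap_l. field. lra. Qed.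

Lemma gap_r_eq A B y y0 : 0 < B * y + A -> 0 < B * y0 + A ->
  gap_r A B y y0 = - (A * B ^ 2 * (y - y0) ^ 2 / ((B * y + A) * (B * y0 + A) ^ 2)).
Proof. intros. unfold gap_r. field. lra. Qed.

Lemma Rdiv_le_cross a b c d : 0 < b -> 0 < d -> a * d <= c * b -> a / b <= c / d.
Proof.
intros Hb Hd Hle. apply Rle_div_l_intro; [lra|].
replace (c / d * b) with (c * b / d) by (field; lra).
apply Rle_div_r_intro; lra.
Qed.

(** Case of a cumulative weight that ends after a right branch. The convex left part wins over the
    concave right part because [A y + B <= B y + A] on [0, 1]. *)
Lemma gap_same_ge0 A B y y0 : 0 < B <= A -> 0 <= y <= 1 -> 0 <= y0 <= 1 ->
  0 <= gap_l A B y y0 + gap_r A B y y0.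
Proof.
intros HB Hy Hy0.
assert (0 < A * y + B) by nra. assert (0 < A * y0 + B) by nra.
assert (0 < B * y + A) by nra. assert (0 < B * y0 + A) by nra.
rewrite gap_l_eq, gap_r_eq by assumption.
cut (A * B ^ 2 * (y - y0) ^ 2 / ((B * y + A) * (B * y0 + A) ^ 2) <=
     A ^ 2 * B * (y - y0) ^ 2 / ((A * y + B) * (A * y0 + B) ^ 2)); [lra|].
apply Rdiv_le_cross;
  [apply Rmult_lt_0_compat; [|apply pow_lt]; assumption..|].
assert (A * y + B <= B * y + A) by nra.
assert ((A * y0 + B) ^ 2 <= (B * y0 + A) ^ 2) by (apply pow_incr; nra).
assert (B * ((A * y + B) * (A * y0 + B) ^ 2) <= A * ((B * y + A) * (B * y0 + A) ^ 2)).
{ apply Rmult_le_compat; [lra| |lra|].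
  - apply Rmult_le_pos; [lra|apply pow2_ge_0].
  - apply Rmult_le_compat; [lra|apply pow2_ge_0|lra|lra]. }
assert (0 <= A * B * (y - y0) ^ 2) by (apply Rmult_le_pos; [nra|apply pow2_ge_0]).
nra.
Qed.

(** Case of a cumulative weight that ends after a left branch, one index ahead of the right ones.
    The key comparison [I2] reduces to [C A y0^2 <= B^2], which the determinant supplies. *)
Lemma gap_next_ge0 A B C y y0 :
  0 <= C <= B -> 1 <= B <= A -> B ^ 2 - C * A = 1 -> 0 <= y <= 1 -> 0 <= y0 <= 1 ->
  0 <= gap_l A B y y0 + gap_r B C y y0.
Proof.
intros HC HB Hd Hy Hy0.
assert (0 < A * y + B) by nra. assert (0 < A * y0 + B) by nra.
assert (0 < C * y + B) by nra. assert (0 < C * y0 + B) by nra.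
rewrite gap_l_eq, gap_r_eq by assumption.
cut (B * C ^ 2 * (y - y0) ^ 2 / ((C * y + B) * (C * y0 + B) ^ 2) <=
     A ^ 2 * B * (y - y0) ^ 2 / ((A * y + B) * (A * y0 + B) ^ 2)); [lra|].
apply Rdiv_le_cross;
  [apply Rmult_lt_0_compat; [|apply pow_lt]; assumption..|].
assert (I1 : C * (A * y + B) <= A * (C * y + B)) by nra.
assert (I2 : C * (A * y0 + B) ^ 2 <= A * (C * y0 + B) ^ 2).
{ apply Rminus_le.
  replace (_ - _) with ((A - C) * (C * A * y0 ^ 2 - B ^ 2)) by ring.
  assert (y0 ^ 2 <= 1) by nra. assert (0 <= C * A) by nra.
  assert (C * A * y0 ^ 2 <= C * A) by nra. assert (C * A * y0 ^ 2 - B ^ 2 <= 0) by lra. nra. }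
assert (I3 : (C * (A * y + B)) * (C * (A * y0 + B) ^ 2) <=
             (A * (C * y + B)) * (A * (C * y0 + B) ^ 2)).
{ pose proof (pow2_ge_0 (A * y0 + B)).
  apply Rmult_le_compat; try assumption; apply Rmult_le_pos; lra. }
assert (0 <= B * (y - y0) ^ 2) by (apply Rmult_le_pos; [lra|apply pow2_ge_0]).
nra.
Qed.

(** The second derivative of [y / (A y + B)^2] is [2 A (A y - 2 B) / (A y + B)^4], nonpositive here.
    The tangent inequality is checked through its exact remainder. *)
Lemma moebius_weight_concave A B y y0 : 0 < B -> 0 <= A <= 2 * B -> 0 <= y <= 1 -> 0 <= y0 <= 1 ->
  y / (A * y + B) ^ 2 <= y0 / (A * y0 + B) ^ 2 + (B - A * y0) / (A * y0 + B) ^ 3 * (y - y0).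
Proof.
intros HB HA Hy Hy0.
assert (0 < A * y + B) by nra. assert (0 < A * y0 + B) by nra.
assert (0 <= 2 * B ^ 2 + A * y * (B - A * y0)).
{ assert (A * y0 <= A) by nra. assert (0 <= A * y <= A) by nra. nra. }
apply Rminus_le.
replace (_ - _) with
  (- (A * (y - y0) ^ 2 * (2 * B ^ 2 + A * y * (B - A * y0))
      / ((A * y + B) ^ 2 * (A * y0 + B) ^ 3))) by (field; lra).
apply Ropp_le_cancel. rewrite Ropp_0, Ropp_involutive.
apply Rdiv_le_0_compat.
- apply Rmult_le_pos; [|assumption]. apply Rmult_le_pos; [lra|apply pow2_ge_0].
- apply Rmult_lt_0_compat; apply pow_lt; assumption.
Qed.

(** Monotonicity and concavity of [x * f x], expressed by supporting lines instead of derivatives,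
    since the generating functions [min(x, c)] have a corner. *)
Definition cone (f : R -> R) : Prop :=
  (forall x, 0 <= x <= 1 -> 0 <= f x) /\
  (forall x0, 0 < x0 <= 1 -> exists s, 0 <= s /\
     forall x, 0 <= x <= 1 -> x * f x <= x0 * f x0 + s * (x - x0)).

Section Abel.

Context {la : R} {sg : nat -> R} {m : nat} (H : ladder la sg m).

(** Summation by parts along the ordered branches: the coefficients increase and all partial sums of
    the gap increments are nonnegative, so replacing each coefficient by the last one can only raise
    the sum. *)
Lemma abel_weights (u v : nat -> R) n y y0 : (n <= m)%nat -> 0 <= y <= 1 -> 0 <= y0 <= 1 ->
  (forall i, (i <= n)%nat -> 0 <= u i <= v i) ->
  (forall i, (S i <= n)%nat -> v i <= u (S i)) ->
  sum_f_R0 (fun i =>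
      u i * (gap_l (sg (S (S i))) (sg (S i)) y y0 - gap_l (sg (S i)) (sg i) y y0)
    + v i * (gap_r (sg (S (S i))) (sg (S i)) y y0 - gap_r (sg (S i)) (sg i) y y0)) n
  <= v n * (gap_l (sg (S (S n))) (sg (S n)) y y0 + gap_r (sg (S (S n))) (sg (S n)) y y0).
Proof.
intros Hn Hy Hy0 Huv Hvu. induction n as [|n IH].
- simpl sum_f_R0. pose proof (ladder_step H 0 Hn) as Hs. pose proof (ladder_det H 0) as Hd.
  pose proof (gap_next_ge0 _ _ _ y y0 ltac:(split; apply Hs) ltac:(split; apply Hs) Hd Hy Hy0) as Hg.
  rewrite (ladder_0 _ _ _ H) in *.
  (* Nothing precedes the first cell: with [B = 0] both cumulative weights vanish identically. *)
  assert (E1 : gap_l (sg 1%nat) 0 y y0 = 0) by (unfold gap_l, Rdiv; ring).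
  assert (E2 : gap_r (sg 1%nat) 0 y y0 = 0) by (unfold gap_r, Rdiv; ring).
  rewrite E1, E2 in *. pose proof (Huv 0%nat (le_n 0)). nra.
- rewrite tech5.
  pose proof (ladder_step H (S n) Hn) as Hs. pose proof (ladder_det H (S n)) as Hd.
  pose proof (gap_next_ge0 _ _ _ y y0 ltac:(split; apply Hs) ltac:(split; apply Hs) Hd Hy Hy0) as Hg.
  pose proof (ladder_step H n ltac:(lia)) as Hs'.
  pose proof (gap_same_ge0 (sg (S (S n))) (sg (S n)) y y0 ltac:(lra) Hy Hy0) as Hg'.
  specialize (IH ltac:(lia) ltac:(intros; apply Huv; lia) ltac:(intros; apply Hvu; lia)).
  pose proof (Huv (S n) (le_n _)). pose proof (Hvu n (le_n _)). nra.
Qed.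

End Abel.

Section ConeTransfer.

Context {la : R} {sg : nat -> R} {m : nat} (H : ladder la sg m).
Context (f s : R -> R) (f_ge0 : forall x, 0 <= x <= 1 -> 0 <= f x).
Context (s_ge0 : forall z, 0 < z <= 1 -> 0 <= s z).
Context (f_line : forall z, 0 < z <= 1 ->
  forall x, 0 <= x <= 1 -> x * f x <= z * f z + s z * (x - z)).

(** Height at which the supporting line at [z] meets the vertical axis. *)
Let icpt z := z * f z - s z * z.

Lemma intercept_ge0 z : 0 < z <= 1 -> 0 <= icpt z.
Proof. intros Hz. pose proof (f_line z Hz 0 ltac:(lra)). unfold icpt. lra. Qed.

Lemma slope_anti z z' : 0 < z -> z <= z' -> z' <= 1 -> s z' <= s z.
Proof.
intros Hz [Hlt|<-] Hz'; [|lra].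
pose proof (f_line z ltac:(lra) z' ltac:(lra)).
pose proof (f_line z' ltac:(lra) z ltac:(lra)). nra.
Qed.

(** The line at [z'] passes above the point of the graph at [z] and descends less steeply towards 0,
    so it meets the axis higher. *)
Lemma intercept_mono z z' : 0 < z -> z <= z' -> z' <= 1 -> icpt z <= icpt z'.
Proof.
intros Hz Hle Hz'. pose proof (slope_anti z z' Hz Hle Hz').
pose proof (f_line z' ltac:(lra) z ltac:(lra)). unfold icpt. nra.
Qed.

(** Derivative at [y0] of the sum of intercept times weight and slope times (weight times branch),
    with intercepts and slopes frozen at the inverse images of [y0]. *)
Let line_slope y0 := sum_f_R0 (fun i =>
    icpt (zl sg i y0) * (sg (S i) * sg i / (sg (S i) * y0 + sg i) ^ 2
                         - sg (S (S i)) * sg (S i) / dl sg i y0 ^ 2)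
  + icpt (zr sg i y0) * (sg (S (S i)) * sg (S i) / dr sg i y0 ^ 2
                         - sg (S i) * sg i / (sg i * y0 + sg (S i)) ^ 2)
  + s (zl sg i y0) * ((sg (S i) - sg (S (S i)) * y0) / dl sg i y0 ^ 3)
  + s (zr sg i y0) * ((sg (S (S i)) - sg (S i) * y0) / dr sg i y0 ^ 3)) m.

Lemma transfer_line y y0 : 0 <= y <= 1 -> 0 < y0 <= 1 ->
  y * transfer sg m f y <= y0 * transfer sg m f y0 + line_slope y0 * (y - y0).
Proof.
intros Hy Hy0.
cut (y * transfer sg m f y - y0 * transfer sg m f y0 - (y - y0) * line_slope y0 <= 0); [lra|].
rewrite !(transfer_markov H) by lra. unfold line_slope.
rewrite scal_sum, <- !minus_sum.
set (u := fun i => icpt (zl sg i y0)). set (v := fun i => icpt (zr sg i y0)).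
transitivity (sum_f_R0 (fun i =>
      u i * (gap_l (sg (S (S i))) (sg (S i)) y y0 - gap_l (sg (S i)) (sg i) y y0)
    + v i * (gap_r (sg (S (S i))) (sg (S i)) y y0 - gap_r (sg (S i)) (sg i) y y0)) m).
- apply sum_Rle. intros i Hi.
  pose proof (zl_bounds H i y Hi Hy) as Bl. pose proof (zr_bounds H i y Hi Hy) as Br.
  pose proof (zl_bounds H i y0 Hi ltac:(lra)) as Bl0. pose proof (zr_bounds H i y0 Hi ltac:(lra)) as Br0.
  pose proof (zl_pos H i y0 Hi Hy0).
  pose proof (f_line (zl sg i y0) ltac:(lra) (zl sg i y) Bl) as Ll.
  pose proof (f_line (zr sg i y0) ltac:(lra) (zr sg i y) ltac:(lra)) as Lr.
  apply (Rmult_le_compat_l _ _ _ (pl_ge0 H i y Hi ltac:(lra))) in Ll.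
  apply (Rmult_le_compat_l _ _ _ (pr_ge0 H i y Hi ltac:(lra))) in Lr.
  pose proof (weight_l H i y Hi ltac:(lra)) as Wl. pose proof (weight_r H i y Hi ltac:(lra)) as Wr.
  pose proof (weight_l H i y0 Hi ltac:(lra)) as Wl0. pose proof (weight_r H i y0 Hi ltac:(lra)) as Wr0.
  pose proof (ladder_step H i Hi) as Hs.
  pose proof (moebius_weight_concave (sg (S (S i))) (sg (S i)) y y0 ltac:(lra) ltac:(lra) Hy ltac:(lra)) as Cl.
  pose proof (moebius_weight_concave (sg (S i)) (sg (S (S i))) y y0 ltac:(lra) ltac:(lra) Hy ltac:(lra)) as Cr.
  fold (dl sg i y) in Cl. fold (dl sg i y0) in Cl. fold (dr sg i y) in Cr. fold (dr sg i y0) in Cr.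
  rewrite Wl, Wl0 in Cl. rewrite Wr, Wr0 in Cr.
  apply (Rmult_le_compat_l _ _ _ (s_ge0 (zl sg i y0) ltac:(lra))) in Cl.
  apply (Rmult_le_compat_l _ _ _ (s_ge0 (zr sg i y0) ltac:(lra))) in Cr.
  unfold u, v, icpt, gap_l, gap_r.
  fold (dl sg i y) (dl sg i y0) (dr sg i y) (dr sg i y0).
  unfold pl, pr in *.
  (* Once the fractions are named, the claim is linear in [Ll], [Lr], [Cl], [Cr]. *)
  set (a1 := sg (S i) / dl sg i y) in *. set (a2 := sg i / (sg (S i) * y + sg i)) in *.
  set (a3 := sg (S i) / dl sg i y0) in *. set (a4 := sg i / (sg (S i) * y0 + sg i)) in *.
  set (a5 := sg (S i) * y / dr sg i y) in *. set (a6 := sg i * y / (sg i * y + sg (S i))) in *.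
  set (a7 := sg (S i) * y0 / dr sg i y0) in *. set (a8 := sg i * y0 / (sg i * y0 + sg (S i))) in *.
  set (b1 := _ / dl sg i y0 ^ 3) in *. set (b2 := _ / dr sg i y0 ^ 3) in *.
  set (c1 := _ / dl sg i y0 ^ 2). set (c2 := _ / dr sg i y0 ^ 2).
  set (c3 := _ / (sg (S i) * y0 + sg i) ^ 2). set (c4 := _ / (sg i * y0 + sg (S i)) ^ 2).
  lra.
- transitivity (v m * (gap_l (sg (S (S m))) (sg (S m)) y y0 + gap_r (sg (S (S m))) (sg (S m)) y y0)).
  + apply (abel_weights H); try lra; auto; unfold u, v; intros i Hi.
    * pose proof (zl_bounds H i y0 Hi ltac:(lra)) as Bl0. pose proof (zr_bounds H i y0 Hi ltac:(lra)) as Br0.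
      pose proof (zl_pos H i y0 Hi Hy0). split.
      -- apply intercept_ge0. lra.
      -- apply intercept_mono; try lra. apply (zl_le_zr H); lra || lia.
    * pose proof (zl_bounds H (S i) y0 Hi ltac:(lra)) as Bl0.
      pose proof (zr_bounds H i y0 ltac:(lia) ltac:(lra)) as Br0.
      apply intercept_mono; try lra. apply (zr_le_zl_S H); lra || lia.
  (* The full cumulative weight is the constant 1, whose deviation from its tangent is 0. *)
  + rewrite (ladder_top _ _ _ H). pose proof (ladder_step H m (le_n m)).
    apply Req_le. replace (_ + _) with 0; [ring|].
    unfold gap_l, gap_r. field. split; apply Rgt_not_eq; nra.
Qed.

(** At 1 the two branches of a cell have the same value, while their weights, and their products
    weight times branch, have opposite derivatives. *)
Lemma line_slope_1 : line_slope 1 = 0.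
Proof.
unfold line_slope. transitivity (sum_f_R0 (fun _ => 0) m); [|rewrite sum_cte; ring].
apply sum_eq. intros i Hi.
assert (E : zr sg i 1 = zl sg i 1).
{ unfold zl, zr, dl, dr. f_equal; ring. }
assert (E' : dr sg i 1 = dl sg i 1) by (unfold dl, dr; ring).
rewrite E, E'. replace (sg i * 1 + sg (S i)) with (sg (S i) * 1 + sg i) by ring.
unfold Rdiv. ring.
Qed.

Lemma transfer_cone_of_slopes : cone (transfer sg m f).
Proof.
split.
- intros x Hx. unfold transfer.
  transitivity (sum_f_R0 (fun _ => 0) m); [rewrite sum_cte; lra|].
  apply sum_Rle. intros i Hi.
  pose proof (dl_pos H i x Hi ltac:(lra)). pose proof (dr_pos H i x Hi ltac:(lra)).
  pose proof (zl_bounds H i x Hi Hx). pose proof (zr_bounds H i x Hi Hx).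
  apply Rplus_le_le_0_compat; apply Rdiv_le_0_compat; try (apply f_ge0; lra); apply pow_lt; lra.
- intros y0 Hy0. exists (line_slope y0). split.
  (* The line at 1 is horizontal, so the value at 1 is maximal; the line at [y0 < 1] must still pass
     above it, hence its slope is nonnegative. *)
  + destruct (proj2 Hy0) as [Hlt| ->]; [|rewrite line_slope_1; lra].
    pose proof (transfer_line y0 1 ltac:(lra) ltac:(lra)) as L1. rewrite line_slope_1 in L1.
    pose proof (transfer_line 1 y0 ltac:(lra) Hy0). nra.
  + intros y Hy. apply transfer_line; assumption.
Qed.

End ConeTransfer.

Lemma transfer_cone la sg m f : ladder la sg m -> cone f -> cone (transfer sg m f).
Proof.
intros H [f_ge0 f_line].
assert (Hs : exists s : R -> R, forall z, 0 < z <= 1 -> 0 <= s z /\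
  forall x, 0 <= x <= 1 -> x * f x <= z * f z + s z * (x - z)).
{ exists (fun z => epsilon (inhabits 0) (fun s => 0 <= s /\
    forall x, 0 <= x <= 1 -> x * f x <= z * f z + s * (x - z))).
  intros z Hz. apply epsilon_spec. apply f_line, Hz. }
destruct Hs as [s Hs].
apply (transfer_cone_of_slopes H f s f_ge0); intros z Hz; apply Hs, Hz.
Qed.

Lemma cone_mono f x y : cone f -> 0 <= x -> x <= y -> 0 < y <= 1 -> x * f x <= y * f y.
Proof.
intros [_ Hf] Hx Hxy Hy. destruct (Hf y Hy) as (s & Hs & Hl).
pose proof (Hl x ltac:(lra)). nra.
Qed.

(** * Conservation of the integral *)

(** Two-sided continuity even at 0 and 1. Functions continuous only relative to [0, 1] are first
    composed with [clamp]. *)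
Definition continuous01 (f : R -> R) := forall x, 0 <= x <= 1 -> continuous f x.

Lemma continuous01_ex_RInt f a b : continuous01 f -> 0 <= a <= 1 -> 0 <= b <= 1 -> ex_RInt f a b.
Proof.
intros Hf Ha Hb. apply (ex_RInt_continuous (V := R_CompleteNormedModule)).
intros z Hz. apply Hf. revert Hz. apply Rmin_case; apply Rmax_case; lra.
Qed.

Lemma continuous_sum_f_R0 (F : nat -> R -> R) n x :
  (forall i, (i <= n)%nat -> continuous (F i) x) ->
  continuous (fun y => sum_f_R0 (fun i => F i y) n) x.
Proof.
induction n as [|n IH]; intros HF; simpl.
- apply HF. lia.
- apply (continuous_plus (fun y => sum_f_R0 (fun i => F i y) n) (F (S n))).
  + apply IH. intros i Hi. apply HF. lia.
  + apply HF. lia.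
Qed.

Section Integral.

Context {la : R} {sg : nat -> R} {m : nat} (H : ladder la sg m).

Lemma is_derive_zl i y : (i <= m)%nat -> 0 <= y -> is_derive (zl sg i) y (/ dl sg i y ^ 2).
Proof.
intros Hi Hy. pose proof (dl_pos H i y Hi Hy). unfold zl, dl in *. auto_derive; [lra|].
transitivity ((sg (S i) ^ 2 - sg i * sg (S (S i))) / (sg (S (S i)) * y + sg (S i)) ^ 2).
- field. lra.
- rewrite (ladder_det H). field. lra.
Qed.

Lemma is_derive_zr i y : (i <= m)%nat -> 0 <= y -> is_derive (zr sg i) y (- / dr sg i y ^ 2).
Proof.
intros Hi Hy. pose proof (dr_pos H i y Hi Hy). unfold zr, dr in *. auto_derive; [lra|].
transitivity (- (sg (S i) ^ 2 - sg i * sg (S (S i))) / (sg (S i) * y + sg (S (S i))) ^ 2).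
- field. lra.
- rewrite (ladder_det H). field. lra.
Qed.

Lemma continuous_dl i y : (i <= m)%nat -> 0 <= y -> continuous (fun y => / dl sg i y ^ 2) y.
Proof.
intros Hi Hy. pose proof (dl_pos H i y Hi Hy). apply (ex_derive_continuous (V := R_NormedModule)).
unfold dl in *. auto_derive. nra.
Qed.

Lemma continuous_dr i y : (i <= m)%nat -> 0 <= y -> continuous (fun y => / dr sg i y ^ 2) y.
Proof.
intros Hi Hy. pose proof (dr_pos H i y Hi Hy). apply (ex_derive_continuous (V := R_NormedModule)).
unfold dr in *. auto_derive. nra.
Qed.

Lemma transfer_continuous f : continuous01 f -> continuous01 (transfer sg m f).
Proof.
intros Hf y Hy. unfold transfer.
apply (continuous_sum_f_R0 (fun i y => f (zl sg i y) / dl sg i y ^ 2 + f (zr sg i y) / dr sg i y ^ 2)).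
intros i Hi.
apply (continuous_plus (fun y => f (zl sg i y) / dl sg i y ^ 2) (fun y => f (zr sg i y) / dr sg i y ^ 2)).
- apply (continuous_mult (fun y => f (zl sg i y)) (fun y => / dl sg i y ^ 2)).
  + apply (continuous_comp (zl sg i) f).
    * apply (ex_derive_continuous (V := R_NormedModule)). eexists. apply is_derive_zl; [assumption|lra].
    * apply Hf, (zl_bounds H); assumption.
  + apply continuous_dl; [assumption|lra].
- apply (continuous_mult (fun y => f (zr sg i y)) (fun y => / dr sg i y ^ 2)).
  + apply (continuous_comp (zr sg i) f).
    * apply (ex_derive_continuous (V := R_NormedModule)). eexists. apply is_derive_zr; [assumption|lra].
    * apply Hf. pose proof (zr_bounds H i y Hi Hy). lra.
  + apply continuous_dr; [assumption|lra].
Qed.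

(** Change of variables: [zl i] rises from the left end of the cell and [zr i] falls from the right
    end, and they meet at their common value at 1. *)
Lemma is_RInt_branches f i : continuous01 f -> (i <= m)%nat ->
  is_RInt (fun y => f (zl sg i y) / dl sg i y ^ 2 + f (zr sg i y) / dr sg i y ^ 2) 0 1
    (RInt f (sg i / sg (S i)) (sg (S i) / sg (S (S i)))).
Proof.
intros Hf Hi. pose proof (ladder_step H i Hi) as Hs.
assert (E0 : zl sg i 0 = sg i / sg (S i)) by (unfold zl, dl; field; lra).
assert (E1 : zr sg i 0 = sg (S i) / sg (S (S i))) by (unfold zr, dr; field; lra).
assert (E2 : zr sg i 1 = zl sg i 1) by (unfold zl, zr, dl, dr; f_equal; ring).
pose proof (zl_bounds H i 0 Hi ltac:(lra)). pose proof (zl_bounds H i 1 Hi ltac:(lra)).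
pose proof (zr_bounds H i 0 Hi ltac:(lra)).
rewrite <- E0, <- E1.
rewrite <- (RInt_Chasles f (zl sg i 0) (zl sg i 1) (zr sg i 0)) by
  (apply continuous01_ex_RInt; try assumption; lra).
apply (is_RInt_plus (V := R_NormedModule)
  (fun y => f (zl sg i y) / dl sg i y ^ 2) (fun y => f (zr sg i y) / dr sg i y ^ 2)).
- apply (is_RInt_ext (fun y => scal (/ dl sg i y ^ 2) (f (zl sg i y)))).
  { intros. unfold scal; simpl; unfold mult; simpl. unfold Rdiv. ring. }
  apply (is_RInt_comp (V := R_CompleteNormedModule) f (zl sg i)).
  + intros x Hx. rewrite Rmin_left, Rmax_right in Hx by lra. apply Hf, (zl_bounds H); assumption.
  + intros x Hx. rewrite Rmin_left, Rmax_right in Hx by lra. split.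
    * apply is_derive_zl; [assumption|lra].
    * apply continuous_dl; [assumption|lra].
- rewrite <- E2.
  rewrite <- (opp_RInt_swap f) by
    (apply continuous01_ex_RInt; try assumption; rewrite ?E2; lra).
  apply (is_RInt_ext (fun y => opp (scal (- / dr sg i y ^ 2) (f (zr sg i y))))).
  { intros. unfold scal, opp; simpl; unfold mult; simpl. unfold Rdiv. ring. }
  apply (is_RInt_opp (V := R_NormedModule) (fun y => scal (- / dr sg i y ^ 2) (f (zr sg i y)))).
  apply (is_RInt_comp (V := R_CompleteNormedModule) f (zr sg i)).
  + intros x Hx. rewrite Rmin_left, Rmax_right in Hx by lra. apply Hf.
    pose proof (zr_bounds H i x Hi Hx). lra.
  + intros x Hx. rewrite Rmin_left, Rmax_right in Hx by lra. split.
    * apply is_derive_zr; [assumption|lra].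
    * apply (continuous_opp (fun y => / dr sg i y ^ 2)). apply continuous_dr; [assumption|lra].
Qed.

Lemma is_RInt_partial_transfer f n : continuous01 f -> (n <= m)%nat ->
  is_RInt (fun y => sum_f_R0 (fun i =>
      f (zl sg i y) / dl sg i y ^ 2 + f (zr sg i y) / dr sg i y ^ 2) n) 0 1
    (RInt f 0 (sg (S n) / sg (S (S n)))).
Proof.
intros Hf. induction n as [|n IH]; intros Hn.
- simpl sum_f_R0. replace 0 with (sg 0%nat / sg 1%nat) at 2.
  + apply is_RInt_branches; assumption.
  + rewrite (ladder_0 _ _ _ H). unfold Rdiv. ring.
- pose proof (ladder_step H n ltac:(lia)). pose proof (ladder_step H (S n) Hn).
  assert (B : forall a b, 0 <= a <= b -> 1 <= b -> 0 <= a / b <= 1).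
  { intros a b Ha Hb. split; [apply Rdiv_le_0_compat; lra|apply Rle_div_l_intro; lra]. }
  pose proof (B (sg (S n)) (sg (S (S n))) ltac:(lra) ltac:(lra)).
  pose proof (B (sg (S (S n))) (sg (S (S (S n)))) ltac:(lra) ltac:(lra)).
  rewrite <- (RInt_Chasles f 0 (sg (S n) / sg (S (S n)))) by
    (apply continuous01_ex_RInt; try assumption; lra).
  apply (is_RInt_plus (V := R_NormedModule) (fun y => sum_f_R0 (fun i =>
    f (zl sg i y) / dl sg i y ^ 2 + f (zr sg i y) / dr sg i y ^ 2) n)).
  + apply IH. lia.
  + apply is_RInt_branches; assumption.
Qed.

Lemma RInt_transfer f : continuous01 f -> RInt (transfer sg m f) 0 1 = RInt f 0 1.
Proof.
intros Hf. apply is_RInt_unique.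
pose proof (is_RInt_partial_transfer f m Hf (le_n m)) as HI.
rewrite (ladder_top _ _ _ H) in HI. pose proof (ladder_step H m (le_n m)).
replace (sg (S m) / sg (S m)) with 1 in HI by (field; lra). exact HI.
Qed.

End Integral.

(** * Iteration along the parabolic branch *)

Section OneStep.

Context {la : R} {sg : nat -> R} {m : nat} (H : ladder la sg m).

Lemma first_branch y : zl sg 0 y = y / (1 + la * y) /\ pl sg 0 y = 1 / (1 + la * y).
Proof.
unfold zl, pl, dl. rewrite (ladder_rec _ _ _ H 0), (ladder_0 _ _ _ H), (ladder_1 _ _ _ H).
split.
- f_equal; ring.
- unfold Rdiv. rewrite Rmult_0_l, Rminus_0_r. do 2 f_equal. ring.
Qed.

(** The cut [1 / (1 + la)] is the common value at 1 of the two branches of the first cell; only the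
    parabolic branch leads below it. *)
Lemma zr_ge_cut i y : (i <= m)%nat -> 0 <= y <= 1 -> 1 / (1 + la) <= zr sg i y.
Proof.
intros Hi Hy. pose proof (ladder_step H i Hi). pose proof (ladder_la _ _ _ H).
unfold zr. apply Rdiv_le_cross; [lra|apply (dr_pos H); [assumption|lra]|].
unfold dr. rewrite (ladder_rec _ _ _ H i).
assert (0 <= sg i * y) by nra. assert (0 <= la * (sg i * y)) by nra.
assert (0 <= sg (S i) * (1 - y)) by nra. lra.
Qed.

Lemma zl_S_ge_cut i y : (S i <= m)%nat -> 0 <= y <= 1 -> 1 / (1 + la) <= zl sg (S i) y.
Proof.
intros Hi Hy. transitivity (zr sg i y).
- apply zr_ge_cut; [lia|assumption].
- apply (zr_le_zl_S H); assumption.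
Qed.

Lemma sum_le_first (F : nat -> R) n :
  (forall i, (S i <= n)%nat -> F (S i) <= 0) -> sum_f_R0 F n <= F 0%nat.
Proof.
induction n as [|n IH]; intros HF; simpl.
- lra.
- pose proof (HF n (le_n _)). pose proof (IH ltac:(intros; apply HF; lia)). lra.
Qed.

Lemma sum_ge_first (F : nat -> R) n :
  (forall i, (S i <= n)%nat -> 0 <= F (S i)) -> F 0%nat <= sum_f_R0 F n.
Proof.
induction n as [|n IH]; intros HF; simpl.
- lra.
- pose proof (HF n (le_n _)). pose proof (IH ltac:(intros; apply HF; lia)). lra.
Qed.

(** Since [x * f x] is largest at 1, every weighted difference is nonpositive, and all but the
    parabolic one may be dropped. *)
Lemma transfer_upper f y : cone f -> 0 <= y <= 1 ->
  y * transfer sg m f y - f 1 <=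
  1 / (1 + la * y) * (y / (1 + la * y) * f (y / (1 + la * y)) - f 1).
Proof.
intros Hf Hy. rewrite (transfer_markov_minus H) by lra.
destruct (first_branch y) as [E1 E2]. rewrite <- E1, <- E2.
assert (Hl : forall i, (i <= m)%nat -> pl sg i y * (zl sg i y * f (zl sg i y) - f 1) <= 0).
{ intros i Hi. pose proof (pl_ge0 H i y Hi ltac:(lra)). pose proof (zl_bounds H i y Hi Hy).
  pose proof (cone_mono f (zl sg i y) 1 Hf ltac:(lra) ltac:(lra) ltac:(lra)). nra. }
assert (Hr : forall i, (i <= m)%nat -> pr sg i y * (zr sg i y * f (zr sg i y) - f 1) <= 0).
{ intros i Hi. pose proof (pr_ge0 H i y Hi ltac:(lra)). pose proof (zr_bounds H i y Hi Hy).
  pose proof (cone_mono f (zr sg i y) 1 Hf ltac:(lra) ltac:(lra) ltac:(lra)). nra. }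
etransitivity.
- apply sum_le_first. intros i Hi. pose proof (Hl _ Hi). pose proof (Hr _ Hi). lra.
- simpl. pose proof (Hr 0%nat ltac:(lia)). lra.
Qed.

(** Here the reference value is the one at the cut: the other branches land above it and contribute
    nonnegative differences. *)
Lemma transfer_lower f y : cone f -> 0 <= y <= 1 ->
  1 / (1 + la * y) * (y / (1 + la * y) * f (y / (1 + la * y)) - 1 / (1 + la) * f (1 / (1 + la)))
  <= y * transfer sg m f y - 1 / (1 + la) * f (1 / (1 + la)).
Proof.
intros Hf Hy. rewrite (transfer_markov_minus H) by lra.
destruct (first_branch y) as [E1 E2]. rewrite <- E1, <- E2.
pose proof (ladder_la _ _ _ H).
set (b := 1 / (1 + la)). assert (Hb : 0 < b <= 1).
{ unfold b. split; [apply Rdiv_lt_0_compat; lra|apply Rle_div_l_intro; lra]. }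
assert (Hl : forall i, (S i <= m)%nat -> 0 <= pl sg (S i) y * (zl sg (S i) y * f (zl sg (S i) y) - b * f b)).
{ intros i Hi. pose proof (pl_ge0 H (S i) y Hi ltac:(lra)). pose proof (zl_bounds H (S i) y Hi Hy).
  pose proof (zl_S_ge_cut i y Hi Hy) as Hc. fold b in Hc.
  pose proof (cone_mono f b (zl sg (S i) y) Hf ltac:(lra) ltac:(assumption) ltac:(lra)). nra. }
assert (Hr : forall i, (i <= m)%nat -> 0 <= pr sg i y * (zr sg i y * f (zr sg i y) - b * f b)).
{ intros i Hi. pose proof (pr_ge0 H i y Hi ltac:(lra)). pose proof (zr_bounds H i y Hi Hy).
  pose proof (zr_ge_cut i y Hi Hy) as Hc. fold b in Hc.
  pose proof (cone_mono f b (zr sg i y) Hf ltac:(lra) ltac:(assumption) ltac:(lra)). nra. }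
etransitivity; [|apply sum_ge_first; intros i Hi; pose proof (Hl i Hi); pose proof (Hr _ Hi); lra].
simpl. pose proof (Hr 0%nat ltac:(lia)). lra.
Qed.

End OneStep.

Definition transfer_iter sg m (f : R -> R) n := Nat.iter n (transfer sg m) f.

Section Asymptotics.

Context {la : R} {sg : nat -> R} {m : nat} (H : ladder la sg m).
Context (f : R -> R) (f_cone : cone f) (f_cont : continuous01 f).

Local Notation F := (transfer_iter sg m f).
Local Notation a n := (F n 1).
Local Notation I := (RInt f 0 1).

Lemma iter_cone n : cone (F n).
Proof. induction n as [|n IH]; [exact f_cone|apply (transfer_cone _ _ _ _ H), IH]. Qed.

Lemma iter_continuous n : continuous01 (F n).
Proof. induction n as [|n IH]; [exact f_cont|apply (transfer_continuous H), IH]. Qed.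

Lemma iter_RInt n : RInt (F n) 0 1 = I.
Proof.
induction n as [|n IH]; [reflexivity|].
rewrite <- IH. apply (RInt_transfer H), iter_continuous.
Qed.

Lemma iter_le_top n y : 0 <= y <= 1 -> y * F n y <= a n.
Proof.
intros Hy. rewrite <- (Rmult_1_l (F n 1)).
apply (cone_mono _ _ _ (iter_cone n)); lra.
Qed.

Lemma top_ge0 n : 0 <= a n.
Proof. apply (proj1 (iter_cone n)). lra. Qed.

Lemma shifted y k : 0 <= y <= 1 -> 0 <= k -> 0 <= y / (1 + k * la * y) <= 1.
Proof.
intros Hy Hk. pose proof (ladder_la _ _ _ H). assert (0 <= k * la) by nra.
assert (0 <= k * la * y) by nra. split.
- apply Rdiv_le_0_compat; lra.
- apply Rle_div_l_intro; lra.
Qed.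

Lemma top_decr n : a (S n) <= a n.
Proof.
pose proof (transfer_upper H (F n) 1 (iter_cone n) ltac:(lra)) as U.
pose proof (shifted 1 1 ltac:(lra) ltac:(lra)) as S1. rewrite Rmult_1_l in S1.
pose proof (iter_le_top n _ S1). pose proof (ladder_la _ _ _ H).
assert (0 < 1 / (1 + la * 1)) by (apply Rdiv_lt_0_compat; lra).
change (F (S n) 1) with (transfer sg m (F n) 1). nra.
Qed.

Lemma top_antitone n k : a (n + k) <= a n.
Proof.
induction k as [|k IH]; [rewrite Nat.add_0_r; lra|].
rewrite Nat.add_succ_r. pose proof (top_decr (n + k)). lra.
Qed.

Lemma top_le_0 n : a n <= a 0%nat.
Proof. exact (top_antitone 0 n). Qed.

(** Near 0 the bound [a n / y] is useless. Dividing [transfer_upper] by [y], with [z = p y] and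
    [1 - p = la y p], shows that one step raises the supremum by at most [la * a 0]. *)
Lemma iter_upper_linear M n y : (forall x, 0 < x <= 1 -> f x <= M) -> 0 < y <= 1 ->
  F n y <= M + la * INR n * a 0%nat.
Proof.
intros HM. pose proof (ladder_la _ _ _ H). pose proof (top_ge0 0).
revert y. induction n as [|n IH]; intros y Hy.
- simpl. rewrite Rmult_0_r, Rmult_0_l, Rplus_0_r. apply HM, Hy.
- pose proof (transfer_upper H (F n) y (iter_cone n) ltac:(lra)) as U.
  pose proof (shifted y 1 ltac:(lra) ltac:(lra)) as Sy. rewrite Rmult_1_l in Sy.
  set (z := y / (1 + la * y)) in *. set (p := 1 / (1 + la * y)) in *.
  assert (Hp : 0 < p) by (apply Rdiv_lt_0_compat; nra).
  assert (Hp1 : p <= 1) by (apply Rle_div_l_intro; nra).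
  assert (Ez : z = y * p) by (unfold z, p; field; nra).
  assert (E1 : 1 - p = la * y * p) by (unfold p; field; nra).
  assert (Hz : 0 < z) by (rewrite Ez; nra).
  pose proof (IH z ltac:(lra)) as Fz. pose proof (top_le_0 n). pose proof (top_ge0 n).
  pose proof (proj1 (iter_cone n) z ltac:(lra)).
  change (F (S n) y) with (transfer sg m (F n) y).
  rewrite S_INR.
  apply (Rmult_le_reg_l y); [lra|].
  assert (p * (z * F n z) <= y * F n z).
  { rewrite Ez at 1. replace (p * (y * p * F n z)) with (p * p * (y * F n z)) by ring.
    assert (0 <= y * F n z) by nra. assert (p * p <= 1) by nra. nra. }
  assert ((1 - p) * a n <= y * (la * a 0%nat)).
  { rewrite E1. replace (la * y * p * a n) with (y * (la * (p * a n))) by ring.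
    apply Rmult_le_compat_l; [lra|]. apply Rmult_le_compat_l; [lra|]. nra. }
  assert (y * F n z <= y * (M + la * INR n * a 0%nat)) by (apply Rmult_le_compat_l; lra).
  lra.
Qed.

(** The factor [1 / (1 + n la y)] is the probability of following the parabolic branch for [n]
    steps. Any other branch, taken with probability [1 - p <= la y], reaches a value short of [a n]
    by at most [(1 + la) (a n - a (n + 1))]; these losses telescope. *)
Lemma iter_lower n y : 0 < y <= 1 ->
  (1 - 1 / (1 + INR n * la * y)) * a n - la * (1 + la) * y * (a 0%nat - a n) <= y * F n y.
Proof.
pose proof (ladder_la _ _ _ H) as Hla.
revert y. induction n as [|n IH]; intros y Hy.
- simpl. pose proof (proj1 (iter_cone 0) y ltac:(lra)). simpl in *.
  replace (1 - 1 / (1 + 0 * la * y)) with 0 by field. nra.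
- pose proof (transfer_lower H (F n) y (iter_cone n) ltac:(lra)) as U.
  pose proof (shifted y 1 ltac:(lra) ltac:(lra)) as Sy. rewrite Rmult_1_l in Sy.
  pose proof (transfer_upper H (F n) 1 (iter_cone n) ltac:(lra)) as U1.
  rewrite Rmult_1_l, Rmult_1_r in U1.
  change (F (S n) y) with (transfer sg m (F n) y).
  change (transfer sg m (F n) 1) with (a (S n)) in U1.
  set (g := 1 / (1 + la) * F n (1 / (1 + la))) in *.
  (* This is [transfer_upper] at 1, whose parabolic image is the cut: a large deficit at the cut
     would force a large drop of [a]. *)
  assert (Hg : a n - (1 + la) * (a n - a (S n)) <= g).
  { apply (Rmult_le_compat_l (1 + la)) in U1; [|lra].
    replace ((1 + la) * (1 / (1 + la) * (g - a n))) with (g - a n) in U1 by (field; lra). lra. }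
  set (z := y / (1 + la * y)) in *. set (p := 1 / (1 + la * y)) in *.
  assert (Hp : 0 < p) by (apply Rdiv_lt_0_compat; nra).
  assert (Hp1 : p <= 1) by (apply Rle_div_l_intro; nra).
  assert (Ez : z = y * p) by (unfold z, p; field; nra).
  assert (E1 : 1 - p = la * y * p) by (unfold p; field; nra).
  assert (Hz : 0 < z) by (rewrite Ez; nra).
  pose proof (IH z ltac:(lra)) as Fz. pose proof (top_decr n).
  pose proof (top_le_0 n). pose proof (top_ge0 (S n)). pose proof (pos_INR n).
  assert (0 <= INR n * la) by nra.
  (* Probabilities multiply along the parabolic orbit of [y], because [1/y] grows by [la] at each
     step. *)
  assert (E2 : p * (1 / (1 + INR n * la * z)) = 1 / (1 + INR (S n) * la * y)).
  { rewrite S_INR. unfold p, z. assert (0 <= INR n * la * y) by nra. field.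
    repeat split; apply Rgt_not_eq; nra. }
  set (r := 1 / (1 + INR (S n) * la * y)) in *.
  assert (Hr : r <= 1).
  { unfold r. rewrite S_INR. assert (0 <= INR n * la * y) by nra. apply Rle_div_l_intro; nra. }
  apply (Rmult_le_compat_l p) in Fz; [|lra].
  rewrite Rmult_minus_distr_l in Fz.
  replace (p * ((1 - 1 / (1 + INR n * la * z)) * a n)) with ((p - r) * a n) in Fz
    by (rewrite <- E2; ring).
  assert (p * (la * (1 + la) * z * (a 0%nat - a n)) <= la * (1 + la) * y * (a 0%nat - a n)).
  { rewrite Ez. replace (p * (la * (1 + la) * (y * p) * (a 0%nat - a n)))
      with ((p * p) * (la * (1 + la) * y * (a 0%nat - a n))) by ring.
    assert (0 <= la * (1 + la) * y * (a 0%nat - a n)).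
    { apply Rmult_le_pos; [|lra]. apply Rmult_le_pos; [|lra]. nra. }
    assert (p * p <= 1) by nra. nra. }
  assert ((1 - p) * (a n - (1 + la) * (a n - a (S n))) <= (1 - p) * g) by nra.
  assert ((1 - p) * ((1 + la) * (a n - a (S n))) <= la * (1 + la) * y * (a n - a (S n))).
  { rewrite E1. replace (la * y * p * ((1 + la) * (a n - a (S n))))
      with (p * (la * (1 + la) * y * (a n - a (S n)))) by ring.
    assert (0 <= la * (1 + la) * y * (a n - a (S n))).
    { apply Rmult_le_pos; [|lra]. apply Rmult_le_pos; [|lra]. nra. }
    nra. }
  assert ((1 - r) * a (S n) <= (1 - r) * a n) by nra.
  nra.
Qed.

(** Applied at [y = 1] and read backwards, it bounds [F n] from below at [1 / (1 + k la)] in terms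
    of the drop from [a n] to [a (n + k)]. *)
Lemma iter_shift n k y : 0 < y <= 1 ->
  y * F (n + k) y <= (1 - 1 / (1 + INR k * la * y)) * a n
    + 1 / (1 + INR k * la * y) * (y / (1 + INR k * la * y) * F n (y / (1 + INR k * la * y))).
Proof.
pose proof (ladder_la _ _ _ H) as Hla.
revert y. induction k as [|k IH]; intros y Hy.
- rewrite Nat.add_0_r. simpl. rewrite !Rmult_0_l, Rplus_0_r.
  replace (y / 1) with y by field. lra.
- rewrite Nat.add_succ_r. change (F (S (n + k)) y) with (transfer sg m (F (n + k)) y).
  pose proof (transfer_upper H (F (n + k)) y (iter_cone _) ltac:(lra)) as U.
  pose proof (shifted y 1 ltac:(lra) ltac:(lra)) as Sy. rewrite Rmult_1_l in Sy.
  set (z := y / (1 + la * y)) in *. set (p := 1 / (1 + la * y)) in *.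
  assert (Hp : 0 < p) by (apply Rdiv_lt_0_compat; nra).
  assert (Hp1 : p <= 1) by (apply Rle_div_l_intro; nra).
  assert (Ez : z = y * p) by (unfold z, p; field; nra).
  assert (Hz : 0 < z) by (rewrite Ez; nra).
  pose proof (IH z ltac:(lra)) as Fz.
  pose proof (pos_INR k). assert (0 <= INR k * la) by nra.
  assert (0 <= INR k * la * y) by nra.
  assert (E2 : p * (1 / (1 + INR k * la * z)) = 1 / (1 + INR (S k) * la * y)).
  { rewrite S_INR. unfold p, z. field. repeat split; apply Rgt_not_eq; nra. }
  assert (E3 : z / (1 + INR k * la * z) = y / (1 + INR (S k) * la * y)).
  { rewrite S_INR. unfold z. field. repeat split; apply Rgt_not_eq; nra. }
  rewrite E3 in Fz.
  pose proof (top_antitone n k).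
  apply (Rmult_le_compat_l p) in Fz; [|lra].
  rewrite <- E2. set (w := y / _ * F n _) in *.
  set (r := 1 / (1 + INR k * la * z)) in *.
  nra.
Qed.

End Asymptotics.

(** * Asymptotics in the cone *)

Lemma continuous01_RInt_split f a b c : continuous01 f ->
  0 <= a <= 1 -> 0 <= b <= 1 -> 0 <= c <= 1 -> RInt f a c = RInt f a b + RInt f b c.
Proof.
intros Hf Ha Hb Hc. symmetry.
apply (RInt_Chasles f); apply continuous01_ex_RInt; assumption.
Qed.

Lemma continuous01_bounded f : continuous01 f -> exists M, forall x, 0 <= x <= 1 -> f x <= M.
Proof.
intros Hf. destruct (continuity_ab_maj f 0 1 Rle_0_1) as (x & Hx & _).
- intros c Hc. apply continuity_pt_filterlim, Hf, Hc.
- exists (f x). exact Hx.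
Qed.

Lemma is_lim_seq_ln_INR : is_lim_seq (fun n => ln (INR n)) p_infty.
Proof.
apply (is_lim_comp_seq ln INR p_infty p_infty is_lim_ln_p).
- exists 0%nat. intros n _. discriminate.
- apply is_lim_seq_INR.
Qed.

Lemma eventually_exp_ln_small d K : 0 < d -> 0 < K ->
  eventually (fun n => exp (- d * ln (INR n)) * K < d).
Proof.
intros Hd HK.
assert (L : is_lim_seq (fun n => exp (- d * ln (INR n))) 0).
{ apply (is_lim_comp_seq exp (fun n => - d * ln (INR n)) m_infty 0 is_lim_exp_m).
  - exists 0%nat. intros n _. discriminate.
  - replace m_infty with (Rbar_mult (- d) p_infty).
    + apply is_lim_seq_scal_l, is_lim_seq_ln_INR.
    + simpl. destruct (Rle_dec 0 (- d)); [exfalso; lra|reflexivity]. }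
apply is_lim_seq_spec in L.
assert (He : 0 < d / K) by (apply Rdiv_lt_0_compat; lra).
destruct (L (mkposreal _ He)) as [N HN]. exists N. intros n Hn.
specialize (HN n Hn). simpl in HN. rewrite Rminus_0_r, Rabs_pos_eq in HN by apply Rlt_le, exp_pos.
apply (Rmult_lt_compat_r K) in HN; [|assumption].
replace (d / K * K) with d in HN by (field; lra). exact HN.
Qed.

Lemma is_RInt_scal_inv k a b : 0 < a <= b -> is_RInt (fun x => k / x) a b (k * (ln b - ln a)).
Proof.
intros Hab. rewrite Rmult_minus_distr_l.
apply (is_RInt_derive (V := R_CompleteNormedModule) (fun x => k * ln x)).
- intros x Hx. rewrite Rmin_left, Rmax_right in Hx by lra. auto_derive; [lra|]. field. lra.
- intros x Hx. rewrite Rmin_left, Rmax_right in Hx by lra.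
  apply (ex_derive_continuous (V := R_NormedModule)). auto_derive. lra.
Qed.

Section TopAsymptotics.

Context {la : R} {sg : nat -> R} {m : nat} (H : ladder la sg m).
Context (f : R -> R) (f_cone : cone f) (f_cont : continuous01 f).

Local Notation F := (transfer_iter sg m f).
Local Notation a n := (F n 1).
Local Notation I := (RInt f 0 1).

Lemma iter_ex_RInt n x y : 0 <= x <= 1 -> 0 <= y <= 1 -> ex_RInt (F n) x y.
Proof. apply continuous01_ex_RInt, (iter_continuous H f f_cont). Qed.

(** Below [e] the bound linear in [n] is integrated, above [e] the bound [a n / y]; it serves with
    [e] slightly smaller than [1/n]. *)
Lemma RInt_upper M n e : (forall x, 0 < x <= 1 -> f x <= M) -> 0 < e <= 1 ->
  I <= e * (M + la * INR n * a 0%nat) - a n * ln e.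
Proof.
intros HM He. rewrite <- (iter_RInt H f f_cont n).
rewrite (continuous01_RInt_split (F n) 0 e 1) by (try lra; apply (iter_continuous H f f_cont)).
assert (I1 : RInt (F n) 0 e <= e * (M + la * INR n * a 0%nat)).
{ transitivity (RInt (fun _ => M + la * INR n * a 0%nat) 0 e).
  - apply RInt_le; [lra|apply iter_ex_RInt; lra|apply ex_RInt_const|].
    intros x Hx. apply (iter_upper_linear H f f_cone); [exact HM|lra].
  - rewrite RInt_const. unfold scal; simpl; unfold mult; simpl. lra. }
assert (I2 : RInt (F n) e 1 <= - (a n * ln e)).
{ pose proof (is_RInt_scal_inv (a n) e 1 ltac:(lra)) as HI. rewrite ln_1 in HI.
  replace (a n * (0 - ln e)) with (- (a n * ln e)) in HI by ring.
  rewrite <- (is_RInt_unique _ _ _ _ HI).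
  apply RInt_le; [lra|apply iter_ex_RInt; lra|eexists; exact HI|].
  intros x Hx. apply Rle_div_r_intro; [lra|]. rewrite Rmult_comm.
  apply (iter_le_top H f f_cone). lra. }
lra.
Qed.

Lemma RInt_lower n x y : 0 < x < y -> y <= 1 ->
  (1 - 1 / (1 + INR n * la * x)) * a n * (ln y - ln x) - la * (1 + la) * a 0%nat * y <= I.
Proof.
intros Hx Hy. rewrite <- (iter_RInt H f f_cont n).
pose proof (ladder_la _ _ _ H) as Hla.
pose proof (top_ge0 H f f_cone 0) as A0. pose proof (top_ge0 H f f_cone n) as An.
pose proof (proj1 (iter_cone H f f_cone n)) as Fpos.
rewrite (continuous01_RInt_split (F n) 0 x 1) by (try lra; apply (iter_continuous H f f_cont)).
rewrite (continuous01_RInt_split (F n) x y 1) by (try lra; apply (iter_continuous H f f_cont)).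
assert (I1 : 0 <= RInt (F n) 0 x).
{ apply RInt_ge_0; [lra|apply iter_ex_RInt; lra|]. intros t Ht. apply Fpos. lra. }
assert (I3 : 0 <= RInt (F n) y 1).
{ apply RInt_ge_0; [lra|apply iter_ex_RInt; lra|]. intros t Ht. apply Fpos. lra. }
set (k := (1 - 1 / (1 + INR n * la * x)) * a n). set (c := la * (1 + la) * a 0%nat).
assert (Hla1 : 0 <= la * (1 + la)) by nra.
assert (Hc : 0 <= c) by (apply Rmult_le_pos; assumption).
assert (HI : is_RInt (fun t => k / t - c) x y (k * (ln y - ln x) - c * (y - x))).
{ apply (is_RInt_minus (V := R_NormedModule) (fun t => k / t) (fun _ => c)).
  - apply is_RInt_scal_inv. lra.
  - replace (c * (y - x)) with (scal (y - x) c)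
      by (unfold scal; simpl; unfold mult; simpl; ring).
    apply (is_RInt_const (V := R_NormedModule)). }
assert (I2 : k * (ln y - ln x) - c * (y - x) <= RInt (F n) x y).
{ rewrite <- (is_RInt_unique _ _ _ _ HI).
  apply RInt_le; [lra|eexists; exact HI|apply iter_ex_RInt; lra|].
  intros t Ht. pose proof (iter_lower H f f_cone n t ltac:(lra)) as L.
  assert (Hk : k <= (1 - 1 / (1 + INR n * la * t)) * a n).
  { apply Rmult_le_compat_r; [assumption|]. pose proof (pos_INR n).
    assert (0 <= INR n * la) by nra.
    cut (1 / (1 + INR n * la * t) <= 1 / (1 + INR n * la * x)); [lra|].
    apply Rdiv_le_cross; nra. }
  assert (la * (1 + la) * t * (a 0%nat - a n) <= c * t).
  { unfold c. replace (la * (1 + la) * t * (a 0%nat - a n))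
      with (la * (1 + la) * a 0%nat * t - la * (1 + la) * t * a n) by ring.
    assert (0 <= la * (1 + la) * t) by (apply Rmult_le_pos; lra).
    assert (0 <= la * (1 + la) * t * a n) by (apply Rmult_le_pos; assumption). lra. }
  apply (Rmult_le_reg_l t); [lra|].
  replace (t * (k / t - c)) with (k - c * t) by (field; lra). lra. }
nra.
Qed.

Lemma top_asymptotics : is_lim_seq (fun n => a n * ln (INR n)) I.
Proof.
destruct (continuous01_bounded f f_cont) as [M HM].
assert (HM0 : 0 <= M).
{ pose proof (HM 1 ltac:(lra)). pose proof (proj1 f_cone 1 ltac:(lra)). lra. }
pose proof (ladder_la _ _ _ H) as Hla.
pose proof (fun n => top_ge0 H f f_cone n) as Apos.
assert (A0 : 0 <= a 0%nat) by apply Apos.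
assert (I0 : 0 <= I).
{ apply RInt_ge_0; [lra|apply continuous01_ex_RInt; [assumption|lra|lra]|].
  intros. apply (proj1 f_cone). lra. }
set (K := la * (1 + la) * a 0%nat). assert (Hla1 : 0 <= la * (1 + la)) by nra.
assert (K0 : 0 <= K) by (apply Rmult_le_pos; assumption).
assert (Main : forall d, 0 < d <= 1 / 4 -> eventually (fun n =>
   I - d <= (1 + d) * (a n * ln (INR n)) /\ (1 - 2 * d) * (a n * ln (INR n)) <= I + K * d)).
{ intros d Hd.
  (* With [p = n^-d], the summand 2 yields [p <= d / 2] and the rest yields
     [p (M + la a 0) <= d]. *)
  destruct (eventually_exp_ln_small d (2 + M + la * a 0%nat) ltac:(lra) ltac:(nra)) as [N1 HN1].
  destruct (proj2 (is_lim_seq_spec _ p_infty) is_lim_seq_ln_INR (Rmax 1 (- ln d * (2 / d))))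
    as [N2 HN2].
  exists (S (Nat.max N1 N2)). intros n Hn.
  specialize (HN1 n ltac:(lia)). specialize (HN2 n ltac:(lia)).
  set (x := ln (INR n)) in *.
  pose proof (Rmax_l 1 (- ln d * (2 / d))). pose proof (Rmax_r 1 (- ln d * (2 / d))).
  assert (Hx : 1 < x) by lra.
  assert (Hxd : - ln d < x * (d / 2)).
  { assert (Hd2 : 0 < d / 2) by lra. assert (Hq : - ln d * (2 / d) < x) by lra.
    apply (Rmult_lt_compat_r (d / 2)) in Hq; [|assumption].
    replace (- ln d * (2 / d) * (d / 2)) with (- ln d) in Hq by (field; lra). exact Hq. }
  assert (Hn1 : 0 < INR n) by (apply lt_0_INR; lia).
  assert (En : INR n = exp x) by (unfold x; rewrite exp_ln; auto).
  pose proof (exp_pos (- d * x)) as Ep. set (p := exp (- d * x)) in *.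
  pose proof (Apos n) as Apn.
  assert (t0 : 0 <= a n * x) by nra.
  split.
  (* The cut is [n^-(1+d)]: times [n] it is still [n^-d], and its logarithm costs only the factor
     [1 + d]. *)
  - pose proof (RInt_upper M n (exp (- (1 + d) * x)) ltac:(intros; apply HM; lra)) as U.
    assert (Ee : exp (- (1 + d) * x) = p * exp (- x))
      by (unfold p; rewrite <- exp_plus; f_equal; ring).
    assert (E1 : exp (- x) <= 1) by (rewrite <- exp_0; left; apply exp_increasing; lra).
    assert (E2 : exp (- x) * INR n = 1)
      by (rewrite En, <- exp_plus, Rplus_opp_l; apply exp_0).
    pose proof (exp_pos (- x)).
    assert (p < 1) by (unfold p; rewrite <- exp_0; apply exp_increasing; nra).
    assert (exp (- (1 + d) * x) <= 1) by (rewrite Ee; nra).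
    specialize (U ltac:(split; [apply exp_pos|assumption])).
    rewrite ln_exp in U.
    assert (exp (- (1 + d) * x) * (M + la * INR n * a 0%nat) <= p * (M + la * a 0%nat)).
    { rewrite Ee.
      replace (p * exp (- x) * (M + la * INR n * a 0%nat))
        with (p * (exp (- x) * M + la * a 0%nat * (exp (- x) * INR n))) by ring.
      rewrite E2. apply Rmult_le_compat_l; nra. }
    nra.
  (* The range is [n^-(1-d) < y < d]: at its lower end [n y = n^d], so the parabolic probability is
     at most [n^-d], and the upper end [d] keeps the error term below [K d]. *)
  - set (al := exp (- (1 - d) * x)).
    assert (Hal : 0 < al < d).
    { split; [apply exp_pos|]. unfold al.
      apply (Rlt_le_trans _ (exp (ln d))); [apply exp_increasing|rewrite exp_ln; lra].
      assert (0 < x * (1 - 3 / 2 * d)) by (apply Rmult_lt_0_compat; lra). lra. }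
    pose proof (RInt_lower n al d Hal ltac:(lra)) as L. fold K in L.
    unfold al in L at 2. rewrite ln_exp in L. fold al in L.
    assert (Ena : INR n * al * p = 1).
    { rewrite En. unfold al, p. rewrite <- !exp_plus.
      replace (x + _ + _) with 0 by ring. apply exp_0. }
    assert (r : 1 / (1 + INR n * la * al) <= p).
    { apply Rle_div_l_intro; [nra|].
      replace (p * (1 + INR n * la * al)) with (p + la * (INR n * al * p)) by ring.
      rewrite Ena. lra. }
    assert (0 <= la * a 0%nat) by (apply Rmult_le_pos; lra).
    assert (0 <= p * (M + la * a 0%nat)) by (apply Rmult_le_pos; lra).
    assert (Hp : p <= d / 2) by lra.
    assert ((1 - d / 2) * (a n * (x * (1 - 3 / 2 * d))) <=
       (1 - 1 / (1 + INR n * la * al)) * (a n * (ln d - - (1 - d) * x))).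
    { apply Rmult_le_compat; [lra| |lra|].
      - apply Rmult_le_pos; [lra|]. apply Rmult_le_pos; lra.
      - apply Rmult_le_compat_l; lra. }
    nra. }
apply is_lim_seq_spec. intros eps.
(* As [d <= 1/4], the upper bound gives [t <= 2 (I + K)]; inserting this, [t - I] lies between
   [- d (1 + 2 I + 2 K)] and [d (4 I + 5 K)]. *)
set (C := 1 + 4 * I + 5 * K).
assert (HC : 1 <= C) by (unfold C; lra).
set (d := Rmin (1 / 4) (eps / (2 * C))).
assert (Hd : 0 < d <= 1 / 4).
{ split; [|apply Rmin_l]. apply Rmin_case; [lra|].
  apply Rdiv_lt_0_compat; [apply cond_pos|lra]. }
assert (HdC : d * C < eps).
{ assert (Hle : d <= eps / (2 * C)) by apply Rmin_r.
  apply (Rmult_le_compat_r C) in Hle; [|lra].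
  replace (eps / (2 * C) * C) with (eps / 2) in Hle by (field; lra).
  pose proof (cond_pos eps). lra. }
destruct (Main d Hd) as [N HN]. exists (S N). intros n Hn.
destruct (HN n ltac:(lia)) as [L U].
set (t := a n * ln (INR n)) in *.
assert (Ht0 : 0 <= t).
{ apply Rmult_le_pos; [apply Apos|]. rewrite <- ln_1.
  assert (1 <= INR n) by (apply (le_INR 1); lia).
  destruct (Rle_lt_or_eq_dec 1 (INR n)); [assumption| |subst; rewrite <- e; lra].
  left. apply ln_increasing; lra. }
assert (t <= 2 * (I + K)) by nra.
apply Rabs_def1; unfold C in *; nra.
Qed.

Lemma iter_asymptotics y : 0 < y <= 1 -> is_lim_seq (fun n => ln (INR n) * F n y) (I / y).
Proof.
intros Hy. pose proof top_asymptotics as L0. pose proof (ladder_la _ _ _ H) as Hla.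
(* After [k] steps the parabolic orbit of 1 is at [x = 1 / (1 + k la)], which lies below [y] since
   [la >= 1]. *)
destruct (archimed_cor1 y ltac:(lra)) as (k & Hk & Hk0).
assert (Hk1 : 1 <= INR k) by (apply (le_INR 1); lia).
set (x := 1 / (1 + INR k * la)).
assert (Hx : 0 < x <= y).
{ unfold x. split; [apply Rdiv_lt_0_compat; nra|].
  transitivity (/ INR k); [|lra]. unfold Rdiv. rewrite Rmult_1_l.
  apply Rinv_le_contravar; nra. }
(* [x * F n x] is squeezed between [a n - (a n - a (n + k)) / x] and [a n] *)
assert (Low : forall n, a n - / x * (a n - a (n + k)%nat) <= x * F n x).
{ intros n. pose proof (iter_shift H f f_cone n k 1 ltac:(lra)) as S1.
  rewrite Rmult_1_l, Rmult_1_r in S1. fold x in S1.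
  apply (Rmult_le_compat_l (/ x)) in S1; [|apply Rlt_le, Rinv_0_lt_compat; lra].
  replace (/ x * ((1 - x) * a n + x * (x * F n x))) with (/ x * a n - a n + x * F n x) in S1
    by (field; lra). lra. }
assert (Mono : forall n, x * F n x <= y * F n y).
{ intros n. apply (cone_mono (F n)); [apply (iter_cone H f f_cone)|lra|lra|lra]. }
assert (Up : forall n, y * F n y <= a n).
{ intros n. apply (iter_le_top H f f_cone). lra. }
assert (L1 : is_lim_seq (fun n => a (n + k)%nat * ln (INR (n + k))) I).
{ apply (is_lim_seq_incr_n (fun n => a n * ln (INR n)) k I) in L0. exact L0. }
assert (Az : is_lim_seq (fun n => a n) 0).
{ apply (is_lim_seq_ext_loc (fun n => (a n * ln (INR n)) * / ln (INR n))).
  - destruct (proj2 (is_lim_seq_spec _ p_infty) is_lim_seq_ln_INR 0) as [N HN].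
    exists N. intros n Hn. specialize (HN n Hn). field. lra.
  - replace 0 with (I * 0) by ring.
    apply (is_lim_seq_mult' _ _ I 0 L0).
    apply (is_lim_seq_inv _ p_infty is_lim_seq_ln_INR). discriminate. }
(* A fixed shift changes the logarithm by at most [k], and [a] tends to 0. *)
assert (L2 : is_lim_seq (fun n => a (n + k)%nat * ln (INR n)) I).
{ apply (is_lim_seq_le_le_loc
    (fun n => a (n + k)%nat * ln (INR (n + k)) - a (n + k)%nat * INR k) _
    (fun n => a (n + k)%nat * ln (INR (n + k)))).
  - exists 1%nat. intros n Hn. assert (1 <= INR n) by (apply (le_INR 1); lia).
    rewrite plus_INR. pose proof (top_ge0 H f f_cone (n + k)) as Ap.
    assert (ln (INR n) <= ln (INR n + INR k)) by (apply ln_le; lra).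
    assert (ln (INR n + INR k) <= ln (INR n) + INR k).
    { replace (INR n + INR k) with (INR n * (1 + INR k / INR n)) by (field; lra).
      assert (0 < INR k / INR n) by (apply Rdiv_lt_0_compat; lra).
      rewrite ln_mult by lra.
      assert (ln (1 + INR k / INR n) <= INR k / INR n).
      { rewrite <- (ln_exp (INR k / INR n)) at 2. apply ln_le; [lra|]. apply Rlt_le, exp_ineq1. lra. }
      assert (INR k / INR n <= INR k) by (apply Rle_div_l_intro; nra). lra. }
    nra.
  - replace I with (I - 0 * INR k) by ring.
    apply is_lim_seq_minus'; [exact L1|].
    apply is_lim_seq_mult'; [|apply is_lim_seq_const].
    apply (is_lim_seq_incr_n (fun n => a n) k 0) in Az. exact Az.
  - exact L1. }
apply (is_lim_seq_ext (fun n => / y * (ln (INR n) * (y * F n y)))).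
{ intros n. field. lra. }
replace (I / y) with (/ y * I) by (field; lra).
apply (is_lim_seq_scal_l _ (/ y) I).
apply (is_lim_seq_le_le_loc
  (fun n => a n * ln (INR n) - / x * (a n * ln (INR n) - a (n + k)%nat * ln (INR n))) _
  (fun n => a n * ln (INR n))); [| |exact L0].
- exists 1%nat. intros n Hn. assert (1 <= INR n) by (apply (le_INR 1); lia).
  assert (0 <= ln (INR n)) by (rewrite <- ln_1; apply ln_le; lra).
  pose proof (Low n). pose proof (Mono n). pose proof (Up n). split; nra.
- replace I with (I - / x * (I - I)) at 1 by ring.
  apply is_lim_seq_minus'; [exact L0|].
  apply (is_lim_seq_scal_l _ (/ x) (I - I)). apply is_lim_seq_minus'; [exact L0|exact L2].
Qed.

End TopAsymptotics.

(** * Density *)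

Lemma nonexpansive_continuous (g : R -> R) x :
  (forall y, Rabs (g y - g x) <= Rabs (y - x)) -> continuous g x.
Proof.
intros Hg. apply filterlim_locally. intros eps. exists eps. intros y Hy.
apply (Rle_lt_trans _ _ _ (Hg y) Hy).
Qed.

(** The function [min(x, c) / x], written so that for [c > 0] its value at 0 is 1; [hook 0] is the
    zero function, and [hook 1] is 1 on [0, 1]. *)
Definition hook (c x : R) : R := c / Rmax x c.

Lemma hook_continuous c : 0 <= c -> continuous01 (hook c).
Proof.
intros [Hc|<-] x Hx; unfold hook.
- pose proof (Rmax_r x c).
  apply (continuous_mult (fun _ => c) (fun x => / Rmax x c)); [apply continuous_const|].
  apply (continuous_comp (fun x => Rmax x c) Rinv).
  + apply nonexpansive_continuous. intros y.
    apply Rmax_case_strong; apply Rmax_case_strong; intros; unfold Rabs;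
      repeat destruct Rcase_abs; lra.
  + apply continuity_pt_filterlim, continuity_pt_inv; [apply continuity_pt_id|].
    unfold id. lra.
- apply (continuous_ext (fun _ => 0)); [intros; symmetry; apply Rmult_0_l|apply continuous_const].
Qed.

Lemma mult_hook c x : 0 <= c -> 0 <= x -> x * hook c x = Rmin x c.
Proof.
intros Hc Hx. unfold hook. apply Rmax_case_strong; apply Rmin_case_strong; intros.
- destruct Hx as [Hx|<-]; [replace c with x by lra; field; lra|lra].
- destruct Hx as [Hx|<-]; [field; lra|lra].
- destruct Hc as [Hc|<-]; [field; lra|lra].
- destruct Hc as [Hc|<-]; [replace x with c by lra; field; lra|unfold Rdiv; lra].
Qed.

Lemma hook_cone c : 0 <= c -> cone (hook c).
Proof.
intros Hc. split.
- intros x Hx. unfold hook. destruct Hc as [Hc|<-]; [|unfold Rdiv; lra].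
  pose proof (Rmax_r x c). apply Rdiv_le_0_compat; lra.
- intros x0 Hx0. destruct (Rle_lt_dec x0 c) as [Hle|Hlt].
  + exists 1. split; [lra|]. intros x Hx. rewrite !mult_hook by lra.
    rewrite (Rmin_left x0) by lra. pose proof (Rmin_l x c). lra.
  + exists 0. split; [lra|]. intros x Hx. rewrite !mult_hook by lra.
    rewrite (Rmin_right x0) by lra. pose proof (Rmin_r x c). lra.
Qed.

Lemma hook_low c x : 0 <= x <= c -> 0 < c -> hook c x = 1.
Proof. intros Hx Hc. unfold hook. rewrite Rmax_right by lra. field. lra. Qed.

Lemma hook_high c x : 0 <= c <= x -> hook c x = c / x.
Proof. intros Hx. unfold hook. rewrite Rmax_left by lra. reflexivity. Qed.

Definition node K j := INR j / INR (S K).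

(* [x * tent K j x] is [node K (S j)] times the hat function at [node K (S j)]
   of the mesh [1 / S K]. *)
Definition tent K j x :=
  INR (S j) * (2 * hook (node K (S j)) x - hook (node K j) x - hook (node K (S (S j))) x).

Section Density.

Context {la : R} {sg : nat -> R} {m : nat} (H : ladder la sg m).

Definition equidistributes f := continuous01 f /\ forall y, 0 < y <= 1 ->
  is_lim_seq (fun n => ln (INR n) * transfer_iter sg m f n y) (RInt f 0 1 / y).

Lemma transfer_iter_linear f g c n y :
  transfer_iter sg m (fun x => c * f x + g x) n y =
  c * transfer_iter sg m f n y + transfer_iter sg m g n y.
Proof.
revert y. induction n as [|n IH]; intros y; [reflexivity|].
change (transfer sg m (transfer_iter sg m (fun x => c * f x + g x) n) y =
  c * transfer sg m (transfer_iter sg m f n) y + transfer sg m (transfer_iter sg m g n) y).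
unfold transfer. rewrite scal_sum, <- plus_sum. apply sum_eq. intros i Hi.
rewrite !IH. unfold Rdiv. ring.
Qed.

Lemma transfer_iter_le f g n y : (forall x, 0 <= x <= 1 -> f x <= g x) -> 0 <= y <= 1 ->
  transfer_iter sg m f n y <= transfer_iter sg m g n y.
Proof.
intros Hfg. revert y. induction n as [|n IH]; intros y Hy; [apply Hfg, Hy|].
change (transfer sg m (transfer_iter sg m f n) y <= transfer sg m (transfer_iter sg m g n) y).
apply sum_Rle. intros i Hi.
pose proof (dl_pos H i y Hi ltac:(lra)). pose proof (dr_pos H i y Hi ltac:(lra)).
pose proof (zl_bounds H i y Hi Hy). pose proof (zr_bounds H i y Hi Hy).
apply Rplus_le_compat; (apply Rmult_le_compat_r;
  [apply Rlt_le, Rinv_0_lt_compat, pow_lt; assumption|apply IH; lra]).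
Qed.

Lemma equidistributes_cone f : cone f -> continuous01 f -> equidistributes f.
Proof.
intros Hc Hf. split; [exact Hf|]. intros y Hy. exact (iter_asymptotics H f Hc Hf y Hy).
Qed.

Lemma equidistributes_linear f g c : equidistributes f -> equidistributes g ->
  equidistributes (fun x => c * f x + g x).
Proof.
intros [Cf Lf] [Cg Lg]. split.
- intros x Hx. apply (continuous_plus (fun x => c * f x) g); [|apply Cg, Hx].
  apply (continuous_mult (fun _ => c) f); [apply continuous_const|apply Cf, Hx].
- intros y Hy.
  assert (E : RInt (fun x => c * f x + g x) 0 1 = c * RInt f 0 1 + RInt g 0 1).
  { apply is_RInt_unique.
    apply (is_RInt_plus (V := R_NormedModule) (fun x => c * f x) g).
    - apply (is_RInt_scal (V := R_NormedModule) f). apply (RInt_correct (V := R_CompleteNormedModule)).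
      apply continuous01_ex_RInt; [assumption|lra|lra].
    - apply (RInt_correct (V := R_CompleteNormedModule)).
      apply continuous01_ex_RInt; [assumption|lra|lra]. }
  rewrite E.
  apply (is_lim_seq_ext (fun n => c * (ln (INR n) * transfer_iter sg m f n y)
                                  + ln (INR n) * transfer_iter sg m g n y)).
  { intros n. rewrite transfer_iter_linear. ring. }
  replace (_ / y) with (c * (RInt f 0 1 / y) + RInt g 0 1 / y) by (field; lra).
  apply is_lim_seq_plus'; [|apply Lg, Hy].
  apply (is_lim_seq_scal_l _ c (RInt f 0 1 / y)), Lf, Hy.
Qed.

Lemma equidistributes_sum (G : nat -> R -> R) (c : nat -> R) n :
  (forall i, equidistributes (G i)) ->
  equidistributes (fun x => sum_f_R0 (fun i => c i * G i x) n).
Proof.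
intros HG. assert (H0 : equidistributes (hook 0)).
{ apply equidistributes_cone; [apply hook_cone|apply hook_continuous]; lra. }
assert (Ext : forall f g, (forall x, f x = g x) -> equidistributes f -> equidistributes g).
{ intros f g E. replace g with f by (apply functional_extensionality, E).
  trivial. }
induction n as [|n IH].
- apply (Ext (fun x => c 0%nat * G 0%nat x + hook 0 x)).
  + intros x. unfold hook, Rdiv. simpl. ring.
  + apply equidistributes_linear; [apply HG|exact H0].
- apply (Ext (fun x => c (S n) * G (S n) x + sum_f_R0 (fun i => c i * G i x) n)).
  + intros x. simpl. ring.
  + apply equidistributes_linear; [apply HG|exact IH].
Qed.

(** The iterates are positive, and the constant 1 equidistributes: a uniform error [e] becomes
    eventually an error at most [e (1/y + 1)] after iteration and scaling by the logarithm. *)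
Lemma equidistributes_closed f : continuous01 f ->
  (forall e, 0 < e -> exists g, equidistributes g /\
     forall x, 0 <= x <= 1 -> Rabs (f x - g x) <= e) ->
  equidistributes f.
Proof.
intros Cf Hf. split; [exact Cf|]. intros y Hy.
assert (H1 : equidistributes (hook 1)).
{ apply equidistributes_cone; [apply hook_cone|apply hook_continuous]; lra. }
assert (I1 : RInt (hook 1) 0 1 = 1).
{ rewrite (RInt_ext _ (fun _ => 1)).
  - rewrite RInt_const. unfold scal; simpl; unfold mult; simpl. ring.
  - rewrite Rmin_left, Rmax_right by lra. intros x Hx. apply hook_low; lra. }
destruct H1 as [C1 L1]. specialize (L1 y Hy). rewrite I1 in L1.
apply is_lim_seq_spec in L1. destruct (L1 (mkposreal 1 Rlt_0_1)) as [N1 HN1]. simpl in HN1.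
apply is_lim_seq_spec. intros eps.
assert (Hy1 : 0 < / y) by (apply Rinv_0_lt_compat; lra).
(* Besides [e (1/y + 1)] from the iterates, there is [e] from the convergence for [g] and [e / y]
   from the integrals: in all [2 e (1/y + 1) = eps / 2]. *)
set (e := eps / (4 * (/ y + 1))).
assert (He : 0 < e) by (apply Rdiv_lt_0_compat; [apply cond_pos|lra]).
destruct (Hf e He) as (g & [Cg Lg] & Hg).
specialize (Lg y Hy). apply is_lim_seq_spec in Lg.
destruct (Lg (mkposreal e He)) as [N2 HN2]. simpl in HN2.
exists (S (Nat.max N1 N2)). intros n Hn.
specialize (HN1 n ltac:(lia)). specialize (HN2 n ltac:(lia)).
assert (HI : Rabs (RInt f 0 1 - RInt g 0 1) <= e).
{ assert (Ef : ex_RInt f 0 1) by (apply continuous01_ex_RInt; [assumption|lra|lra]).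
  assert (Eg : ex_RInt g 0 1) by (apply continuous01_ex_RInt; [assumption|lra|lra]).
  replace (RInt f 0 1 - RInt g 0 1) with (RInt (fun x => f x - g x) 0 1).
  - replace e with ((1 - 0) * e) by ring. apply abs_RInt_le_const; [lra| |exact Hg].
    apply (ex_RInt_minus (V := R_NormedModule) f g); assumption.
  - apply (RInt_minus (V := R_CompleteNormedModule) f g); assumption. }
assert (Hln : 0 <= ln (INR n)).
{ rewrite <- ln_1. apply ln_le; [lra|]. apply (le_INR 1). lia. }
set (l := ln (INR n)) in *.
assert (B : forall u v : R -> R, (forall x, 0 <= x <= 1 -> u x <= e + v x) ->
  l * transfer_iter sg m u n y <= e * (l * transfer_iter sg m (hook 1) n y) + l * transfer_iter sg m v n y).
{ intros u v Huv.
  replace (e * _ + _) with (l * transfer_iter sg m (fun x => e * hook 1 x + v x) n y)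
    by (rewrite transfer_iter_linear; ring).
  apply Rmult_le_compat_l; [exact Hln|]. apply transfer_iter_le; [|lra].
  intros x Hx. rewrite hook_low by lra. rewrite Rmult_1_r. apply Huv, Hx. }
pose proof (B f g ltac:(intros x Hx; pose proof (proj1 (Rabs_le_between _ _) (Hg x Hx)); lra)) as B1.
pose proof (B g f ltac:(intros x Hx; pose proof (proj1 (Rabs_le_between _ _) (Hg x Hx)); lra)) as B2.
apply Rabs_def2 in HN1. apply Rabs_def2 in HN2.
apply Rabs_le_between in HI.
assert (HIy : - (e * / y) <= RInt f 0 1 / y - RInt g 0 1 / y <= e * / y).
{ unfold Rdiv. split; nra. }
assert (Ee : 2 * e * (/ y + 1) = eps / 2) by (unfold e; field; split; lra).
pose proof (cond_pos eps).
replace (1 / y) with (/ y) in HN1 by (field; lra).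
assert (e * (l * transfer_iter sg m (hook 1) n y) <= e * (/ y + 1)) by (apply Rmult_le_compat_l; lra).
apply Rabs_def1; lra.
Qed.

Lemma node_ge0 K j : 0 <= node K j.
Proof. apply Rdiv_le_0_compat; [apply pos_INR|apply lt_0_INR; lia]. Qed.

Lemma node_step K j : node K (S j) = node K j + / INR (S K).
Proof. unfold node. rewrite (S_INR j). field. apply not_0_INR. lia. Qed.

Lemma equidistributes_tent K j : equidistributes (tent K j).
Proof.
assert (Hh : forall j, equidistributes (hook (node K j))).
{ intros i. pose proof (node_ge0 K i).
  apply equidistributes_cone; [apply hook_cone|apply hook_continuous]; assumption. }
replace (tent K j) with (fun x => (2 * INR (S j)) * hook (node K (S j)) x
  + ((- INR (S j)) * hook (node K j) x + (- INR (S j) * hook (node K (S (S j))) x + hook 0 x))).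
- do 3 (apply equidistributes_linear; [apply Hh|]).
  apply equidistributes_cone; [apply hook_cone|apply hook_continuous]; lra.
- apply functional_extensionality. intros x.
  unfold tent. replace (hook 0 x) with 0 by (unfold hook, Rdiv; ring). ring.
Qed.

Lemma tent_sum K n x :
  sum_f_R0 (fun j => tent K j x) n =
  INR (S (S n)) * hook (node K (S n)) x - INR (S n) * hook (node K (S (S n))) x - hook (node K 0) x.
Proof.
induction n as [|n IH].
- simpl sum_f_R0. unfold tent. simpl INR. ring.
- rewrite tech5, IH. unfold tent. rewrite !(S_INR (S _)). ring.
Qed.

(** Linear interpolation reproduces the function [x] exactly; divided by [x], this makes the tents a
    partition of unity, up to and including the point 0. *)
Lemma tent_sum_1 K x : 0 <= x <= 1 -> sum_f_R0 (fun j => tent K j x) K = 1.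
Proof.
intros Hx. rewrite tent_sum.
assert (Hk : 0 < INR (S K)) by (apply lt_0_INR; lia).
assert (E1 : node K (S K) = 1) by (unfold node; field; lra).
rewrite (node_step K (S K)), E1. pose proof (Rinv_0_lt_compat _ Hk).
rewrite !hook_low by lra. rewrite S_INR. unfold hook, node. simpl (INR 0). unfold Rdiv. ring.
Qed.

Lemma tent_ge0 K j x : 0 <= x <= 1 -> 0 <= tent K j x.
Proof.
intros Hx. apply Rmult_le_pos; [apply pos_INR|].
pose proof (node_ge0 K j) as Hn. rewrite (node_step K (S j)), node_step.
assert (Hk : 0 < INR (S K)) by (apply lt_0_INR; lia). apply Rinv_0_lt_compat in Hk.
set (h := / INR (S K)) in *. set (t := node K j) in *.
destruct Hx as [[Hx|<-] _].
- apply (Rmult_le_reg_l x); [lra|]. rewrite Rmult_0_r.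
  replace (x * _) with (2 * (x * hook (t + h) x) - x * hook t x - x * hook (t + h + h) x) by ring.
  rewrite !mult_hook by lra.
  repeat apply Rmin_case_strong; lra.
- rewrite !(hook_low (t + h)), !(hook_low (t + h + h)) by lra.
  unfold hook. destruct Hn as [Hn| <-].
  + rewrite Rmax_right by lra. replace (t / t) with 1 by (field; lra). lra.
  + unfold Rdiv. lra.
Qed.

(** To the left of the three nodes all hooks are 1, to the right each is its node over [x]; both are
    affine in the node, so the second difference vanishes. *)
Lemma tent_local K j x : 0 <= x <= 1 -> / INR (S K) < Rabs (x - node K (S j)) -> tent K j x = 0.
Proof.
intros Hx Hd. unfold tent. pose proof (node_ge0 K j) as Hn.
rewrite (node_step K (S j)), node_step in *.
assert (Hk : 0 < INR (S K)) by (apply lt_0_INR; lia). apply Rinv_0_lt_compat in Hk.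
set (h := / INR (S K)) in *. set (t := node K j) in *.
revert Hd. unfold Rabs. destruct (Rcase_abs _); intros Hd.
- rewrite !hook_low by lra. ring.
- rewrite !hook_high by lra. field. lra.
Qed.

Lemma equidistributes_continuous f : continuous01 f -> equidistributes f.
Proof.
intros Hf. apply equidistributes_closed; [exact Hf|]. intros e He.
destruct (unifcont_normed_1d (V := R_NormedModule) f 0 1 Hf (mkposreal e He)) as [d Hd].
destruct (archimed_cor1 d (cond_pos d)) as (N & HN & HN0).
destruct N as [|K]; [lia|].
exists (fun x => sum_f_R0 (fun j => f (node K (S j)) * tent K j x) K). split.
- apply equidistributes_sum. intros j. apply equidistributes_tent.
- intros x Hx.
  replace (f x - _) with (sum_f_R0 (fun j => tent K j x * (f x - f (node K (S j)))) K).
  + apply (Rle_trans _ (sum_f_R0 (fun j => Rabs (tent K j x * (f x - f (node K (S j))))) K)).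
    { apply Rsum_abs. }
    apply (Rle_trans _ (sum_f_R0 (fun j => tent K j x * e) K)).
    * apply sum_Rle. intros j Hj. pose proof (tent_ge0 K j x Hx).
      rewrite Rabs_mult, Rabs_pos_eq by assumption.
      destruct (Rle_lt_dec (Rabs (x - node K (S j))) (/ INR (S K))) as [Hle|Hlt].
      -- apply Rmult_le_compat_l; [assumption|].
         assert (Hnode : 0 <= node K (S j) <= 1).
         { split; [apply node_ge0|]. apply Rle_div_l_intro; [apply lt_0_INR; lia|].
           rewrite Rmult_1_l. apply le_INR. lia. }
         left. apply (Hd (node K (S j)) x Hnode Hx).
         apply (Rle_lt_trans _ _ _ Hle HN).
      -- rewrite tent_local by assumption. lra.
    * rewrite <- scal_sum, tent_sum_1 by assumption. lra.
  + transitivity (f x * sum_f_R0 (fun j => tent K j x) K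
      - sum_f_R0 (fun j => f (node K (S j)) * tent K j x) K).
    * rewrite scal_sum, <- minus_sum. apply sum_eq. intros. ring.
    * rewrite tent_sum_1 by assumption. ring.
Qed.

End Density.

(** * The Hecke group *)

Lemma mat_ext A B : m11 A = m11 B -> m12 A = m12 B -> m21 A = m21 B -> m22 A = m22 B -> A = B.
Proof. destruct A, B. simpl. intros; subst; reflexivity. Qed.

Ltac mat_ring := apply mat_ext; simpl; ring.

Lemma mmul_assoc A B C : mmul A (mmul B C) = mmul (mmul A B) C.
Proof. mat_ring. Qed.

Lemma mmul_I_l A : mmul mI A = A.
Proof. mat_ring. Qed.

Lemma hecke_mul q A B : hecke q A -> hecke q B -> hecke q (mmul A B).
Proof.
intros HA HB. induction HA; rewrite <- ?mmul_assoc.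
- rewrite mmul_I_l. exact HB.
- apply hecke_T. assumption.
- apply hecke_Tinv. assumption.
- apply hecke_S. assumption.
Qed.

Lemma hecke_det q M : hecke q M -> mdet M = 1.
Proof.
induction 1 as [|M _ IH|M _ IH|M _ IH]; rewrite <- ?IH; unfold mdet; simpl; ring.
Qed.

Lemma hecke_gen_T q : hecke q (matT q).
Proof. replace (matT q) with (mmul (matT q) mI) by mat_ring. apply hecke_T, hecke_I. Qed.

Lemma hecke_gen_Tinv q : hecke q (matTinv q).
Proof. replace (matTinv q) with (mmul (matTinv q) mI) by mat_ring. apply hecke_Tinv, hecke_I. Qed.

Lemma hecke_gen_Sinv q : hecke q (Mat 0 (-1) 1 0).
Proof.
replace (Mat 0 (-1) 1 0) with (mmul matS (mmul matS (mmul matS mI))) by mat_ring.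
do 3 apply hecke_S. apply hecke_I.
Qed.

Lemma hecke_opp q M : hecke q M -> hecke q (Mat (- m11 M) (- m12 M) (- m21 M) (- m22 M)).
Proof.
intros HM. replace (Mat _ _ _ _) with (mmul matS (mmul matS M)) by mat_ring.
do 2 apply hecke_S. exact HM.
Qed.

Lemma hecke_adj q M : hecke q M -> hecke q (madj M).
Proof.
induction 1 as [|M _ IH|M _ IH|M _ IH].
- replace (madj mI) with mI by mat_ring. apply hecke_I.
- replace (madj _) with (mmul (madj M) (matTinv q)) by mat_ring.
  apply hecke_mul; [exact IH|apply hecke_gen_Tinv].
- replace (madj _) with (mmul (madj M) (matT q)) by mat_ring.
  apply hecke_mul; [exact IH|apply hecke_gen_T].
- replace (madj _) with (mmul (madj M) (Mat 0 (-1) 1 0)) by mat_ring.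
  apply hecke_mul; [exact IH|apply hecke_gen_Sinv].
Qed.

(** Conjugation by [Q] sends [T] to [S T^-1 S^-1] and [S] to [S^-1]. Hence numerator and denominator
    of a reduced fraction may be exchanged, as the branches [Q g_k] require. *)
Lemma hecke_conj_Q q M : hecke q M -> hecke q (mmul matQ (mmul M matQ)).
Proof.
induction 1 as [|M _ IH|M _ IH|M _ IH].
- replace (mmul _ _) with mI by mat_ring. apply hecke_I.
- replace (mmul _ _) with
    (mmul (mmul matS (mmul (matTinv q) (Mat 0 (-1) 1 0))) (mmul matQ (mmul M matQ))) by mat_ring.
  apply hecke_mul; [|exact IH]. apply hecke_S, hecke_Tinv, hecke_gen_Sinv.
- replace (mmul _ _) with
    (mmul (mmul matS (mmul (matT q) (Mat 0 (-1) 1 0))) (mmul matQ (mmul M matQ))) by mat_ring.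
  apply hecke_mul; [|exact IH]. apply hecke_S, hecke_T, hecke_gen_Sinv.
- replace (mmul _ _) with (mmul (Mat 0 (-1) 1 0) (mmul matQ (mmul M matQ))) by mat_ring.
  apply hecke_mul; [apply hecke_gen_Sinv|exact IH].
Qed.

(** * The ring Z[lambda] and reduced fractions *)

Lemma Zlam_int q n : Zlam q (IZR n).
Proof. exists (n :: nil). simpl. ring. Qed.

Lemma Zlam_add q x y : Zlam q x -> Zlam q y -> Zlam q (x + y).
Proof.
intros [l ->] [l' ->]. revert l'. induction l as [|a l IH]; intros l'; simpl.
- exists l'. ring.
- destruct l' as [|b l']; simpl.
  + exists (a :: l). simpl. ring.
  + destruct (IH l') as [l'' E]. exists ((a + b)%Z :: l''). simpl. rewrite <- E, plus_IZR. ring.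
Qed.

Lemma Zlam_opp q x : Zlam q x -> Zlam q (- x).
Proof.
intros [l ->]. induction l as [|a l [l' IH]].
- exists nil. simpl. ring.
- exists ((- a)%Z :: l'). simpl. rewrite <- IH, opp_IZR. ring.
Qed.

Lemma Zlam_mul_lam q x : Zlam q x -> Zlam q (lam q * x).
Proof. intros [l ->]. exists (0%Z :: l). simpl. ring. Qed.

Lemma hecke_Zlam q M : hecke q M -> Zlam q (m11 M) /\ Zlam q (m21 M).
Proof.
induction 1 as [|M _ [IH1 IH2]|M _ [IH1 IH2]|M _ [IH1 IH2]]; simpl.
- split; apply Zlam_int.
- split.
  + replace (_ + _) with (m11 M + lam q * m21 M) by ring. apply Zlam_add, Zlam_mul_lam; assumption.
  + replace (_ + _) with (m21 M) by ring. assumption.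
- split.
  + replace (_ + _) with (m11 M + - (lam q * m21 M)) by ring.
    apply Zlam_add, Zlam_opp, Zlam_mul_lam; assumption.
  + replace (_ + _) with (m21 M) by ring. assumption.
- split.
  + replace (_ + _) with (m21 M) by ring. assumption.
  + replace (_ + _) with (- m11 M) by ring. apply Zlam_opp. assumption.
Qed.

Lemma reduced_hecke q a c : reduced q a c <-> exists M, hecke q M /\ m11 M = a /\ m21 M = c.
Proof.
split.
- intros (_ & _ & M & HM & _ & Ha & Hc). exists M. auto.
- intros (M & HM & <- & <-). destruct (hecke_Zlam q M HM) as [H1 H2].
  split; [exact H1|split; [exact H2|]]. exists M. pose proof (hecke_det q M HM). auto.
Qed.

Lemma reduced_act q N a c : hecke q N -> reduced q a c ->
  reduced q (m11 N * a + m12 N * c) (m21 N * a + m22 N * c).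
Proof.
intros HN Hac. apply reduced_hecke in Hac. destruct Hac as (M & HM & <- & <-).
apply reduced_hecke. exists (mmul N M). split; [apply hecke_mul; assumption|split; reflexivity].
Qed.

Lemma reduced_opp q a c : reduced q a c -> reduced q (- a) (- c).
Proof.
intros Hac. apply reduced_hecke in Hac. destruct Hac as (M & HM & <- & <-).
apply reduced_hecke. eexists. split; [apply hecke_opp, HM|split; reflexivity].
Qed.

Lemma reduced_swap q a c : reduced q a c -> reduced q c a.
Proof.
intros Hac. apply reduced_hecke in Hac. destruct Hac as (M & HM & <- & <-).
apply reduced_hecke. exists (mmul (mmul matQ (mmul M matQ)) (Mat 0 (-1) 1 0)).
split; [|split; simpl; ring].
apply hecke_mul; [apply hecke_conj_Q, HM|apply hecke_gen_Sinv].
Qed.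

(** * Sine values, cells of the first quadrant, and uniqueness of reduced fractions *)

Definition rung (q j : nat) : R := sq q (INR j).

Section Group.

Context (q : nat) (q3 : (3 <= q)%nat).

Local Notation sg := (rung q).

Lemma INR_q_pos : 3 <= INR q.
Proof. apply (le_INR 3) in q3. simpl in q3. lra. Qed.

Lemma sin_q_pos x : 0 < x < INR q -> 0 < sin (x * PI / INR q).
Proof.
intros Hx. pose proof PI_RGT_0. pose proof INR_q_pos. apply sin_gt_0.
- apply Rdiv_lt_0_compat; nra.
- apply (Rmult_lt_reg_r (INR q)); [lra|].
  replace (x * PI / INR q * INR q) with (x * PI) by (field; lra). nra.
Qed.

Lemma sin_q1_pos : 0 < sin (PI / INR q).
Proof.
pose proof INR_q_pos. pose proof (sin_q_pos 1 ltac:(lra)) as S1.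
rewrite Rmult_1_l in S1. exact S1.
Qed.

Lemma rung_0 : sg 0 = 0.
Proof.
unfold rung, sq. simpl INR. replace (0 * PI / INR q) with 0 by (unfold Rdiv; ring).
rewrite sin_0. unfold Rdiv. ring.
Qed.

Lemma rung_1 : sg 1 = 1.
Proof.
unfold rung, sq. simpl INR. rewrite Rmult_1_l. pose proof sin_q1_pos. field. lra.
Qed.

Lemma rung_rec j : sg (S (S j)) = lam q * sg (S j) - sg j.
Proof.
unfold rung, sq, lam. pose proof sin_q1_pos. pose proof INR_q_pos. rewrite !S_INR.
set (t := PI / INR q) in *.
replace ((INR j + 1 + 1) * PI / INR q) with ((INR j + 1) * t + t) by (unfold t; field; lra).
replace (INR j * PI / INR q) with ((INR j + 1) * t - t) by (unfold t; field; lra).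
replace ((INR j + 1) * PI / INR q) with ((INR j + 1) * t) by (unfold t; field; lra).
rewrite sin_plus, sin_minus. field. lra.
Qed.

Lemma rung_reflect j : (j <= q)%nat -> sg (q - j) = sg j.
Proof.
intros Hj. unfold rung, sq. rewrite minus_INR by assumption. pose proof INR_q_pos.
replace ((INR q - INR j) * PI / INR q) with (PI - INR j * PI / INR q) by (field; lra).
rewrite sin_PI_x. reflexivity.
Qed.

Lemma rung_pos j : (0 < j < q)%nat -> 0 < sg j.
Proof.
intros Hj. apply Rdiv_lt_0_compat; [|exact sin_q1_pos].
apply sin_q_pos. split; [apply lt_0_INR|apply lt_INR]; lia.
Qed.

Lemma rung_q : sg q = 0.
Proof. rewrite <- rung_0, <- (rung_reflect 0), Nat.sub_0_r by lia. reflexivity. Qed.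

Lemma rung_ge0 j : (j <= q)%nat -> 0 <= sg j.
Proof.
intros Hj. destruct (Nat.eq_dec j 0) as [->|H0]; [rewrite rung_0; lra|].
destruct (Nat.eq_dec j q) as [->|Hq]; [rewrite rung_q; lra|].
left. apply rung_pos. lia.
Qed.

Definition cell (j : nat) : mat := Mat (sg (S j)) (sg (S (S j))) (sg j) (sg (S j)).

(** The cell matrix is [(T S^-1)^j T]. *)
Lemma hecke_cell j : hecke q (cell j).
Proof.
induction j as [|j IH].
- replace (cell 0) with (matT q); [apply hecke_gen_T|].
  unfold cell. rewrite rung_rec, rung_0, rung_1. mat_ring.
- replace (cell (S j)) with (mmul (matT q) (mmul (Mat 0 (-1) 1 0) (cell j))).
  + apply hecke_T, hecke_mul; [apply hecke_gen_Sinv|exact IH].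
  + apply mat_ext; simpl; rewrite ?(rung_rec (S j)), ?(rung_rec j); ring.
Qed.

(* Every vector of the Hecke orbit of (1, 0) in the closed first quadrant is
   reached from the two boundary vectors by the cell maps, which preserve the
   quadrant; [cusp] is this positive part of the orbit. *)
Inductive cusp : R -> R -> Prop :=
| cusp_e1 : cusp 1 0
| cusp_e2 : cusp 0 1
| cusp_cell j x y : (S (S j) <= q)%nat -> cusp x y ->
    cusp (m11 (cell j) * x + m12 (cell j) * y) (m21 (cell j) * x + m22 (cell j) * y).

Lemma cusp_ge0 x y : cusp x y -> 0 <= x /\ 0 <= y.
Proof.
induction 1 as [| |j x y Hj _ [IHx IHy]]; [lra|lra|]. simpl.
pose proof (rung_ge0 j ltac:(lia)). pose proof (rung_ge0 (S j) ltac:(lia)).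
pose proof (rung_ge0 (S (S j)) ltac:(lia)). split; nra.
Qed.

(** A cell map reaches an axis only from the same axis, and only if it is the first or the last
    cell; these fix (1, 0) and (0, 1) respectively. *)
Lemma cusp_axes x y : cusp x y -> (y = 0 -> x = 1) /\ (x = 0 -> y = 1).
Proof.
induction 1 as [| |j x y Hj Hc [IH1 IH2]]; [lra|lra|]. simpl.
destruct (cusp_ge0 x y Hc) as [Hx Hy].
pose proof (rung_pos (S j) ltac:(lia)) as Hs.
split; intros E.
- pose proof (rung_ge0 j ltac:(lia)).
  assert (y = 0) by nra. specialize (IH1 ltac:(assumption)). subst.
  destruct j as [|j]; [rewrite rung_1; ring|].
  pose proof (rung_pos (S j) ltac:(lia)). lra.
- pose proof (rung_ge0 (S (S j)) ltac:(lia)).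
  assert (x = 0) by nra. specialize (IH2 ltac:(assumption)). subst.
  destruct (Nat.eq_dec (S (S j)) q) as [Eq|Nq].
  + replace (S j) with (q - 1)%nat by lia. rewrite rung_reflect, rung_1 by lia. ring.
  + pose proof (rung_pos (S (S j)) ltac:(lia)). lra.
Qed.

Ltac cusp_ring Hc :=
  match type of Hc with cusp ?x ?y =>
  match goal with |- cusp ?a ?b =>
    apply (eq_ind x (fun t => cusp t b)); [apply (eq_ind y (cusp x)); [exact Hc|ring]|ring]
  end end.

(** The four quarter turns, by powers of [S], of the positive part; stability under [T] and its
    inverse then shows that it contains the whole orbit of (1, 0). *)
Definition cusp_orbit x y := cusp x y \/ cusp (- x) (- y) \/ cusp (- y) x \/ cusp y (- x).

Lemma cusp_orbit_opp x y : cusp_orbit (- x) (- y) -> cusp_orbit x y.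
Proof. unfold cusp_orbit. rewrite !Ropp_involutive. tauto. Qed.

Lemma cusp_orbit_S x y : cusp_orbit x y -> cusp_orbit y (- x).
Proof. unfold cusp_orbit. rewrite !Ropp_involutive. tauto. Qed.

Lemma rung_pred_q : sg (q - 1) = 1 /\ sg (q - 2) = lam q.
Proof.
rewrite !rung_reflect, rung_1 by lia. split; [reflexivity|].
rewrite rung_rec, rung_1, rung_0. ring.
Qed.

Lemma cusp_last_cell x y : cusp x y -> cusp x (lam q * x + y).
Proof.
intros Hc. pose proof (cusp_cell (q - 2) x y ltac:(lia) Hc) as Hl. simpl in Hl.
replace (S (q - 2)) with (q - 1)%nat in Hl by lia. replace (S (q - 1)) with q in Hl by lia.
destruct rung_pred_q as [E1 E2]. rewrite E1, E2, rung_q in Hl.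
replace x with (1 * x + 0 * y) at 1 by ring.
replace (lam q * x + y) with (lam q * x + 1 * y) by ring. exact Hl.
Qed.

Lemma cusp_first_cell x y : cusp x y -> cusp (x + lam q * y) y.
Proof.
intros Hc. pose proof (cusp_cell 0 x y ltac:(lia) Hc) as Hl. simpl in Hl.
rewrite rung_rec, rung_1, rung_0 in Hl.
replace (x + lam q * y) with (1 * x + (lam q * 1 - 0) * y) by ring.
replace y with (0 * x + 1 * y) at 2 by ring. exact Hl.
Qed.

(* T S permutes the cells cyclically: it maps the j-th cell to the next one. *)
Lemma cusp_orbit_TS x y : cusp x y -> cusp_orbit (y - lam q * x) (- x).
Proof.
intros Hc. apply cusp_orbit_opp. destruct Hc as [| |j x y Hj Hc].
- left. pose proof (cusp_first_cell 0 1 cusp_e2) as Hl.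
  replace (- (0 - lam q * 1)) with (0 + lam q * 1) by ring. rewrite Ropp_involutive. exact Hl.
- right; left. rewrite !Ropp_involutive, Ropp_0, Rmult_0_r, Rminus_0_r. apply cusp_e1.
- simpl. rewrite Ropp_involutive. destruct (Nat.eq_dec (S (S j)) q) as [Eq|Nq].
  + right; right; right. replace (sg (S (S j))) with 0 by (rewrite Eq, rung_q; reflexivity).
    replace (sg j) with (lam q * sg (S j)) by (pose proof (rung_rec j) as E; rewrite Eq, rung_q in E; lra).
    replace (S j) with (q - 1)%nat by lia. rewrite (proj1 rung_pred_q).
    cusp_ring Hc.
  + left. pose proof (cusp_cell (S j) x y ltac:(lia) Hc) as Hl. simpl in Hl.
    rewrite (rung_rec (S j)) in Hl.
    match goal with |- cusp ?a _ => replace a with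
      (sg (S (S j)) * x + (lam q * sg (S (S j)) - sg (S j)) * y)
      by (rewrite (rung_rec j); ring) end. exact Hl.
Qed.

(** [T^-1] undoes the first cell, and it maps cell [j + 1] to [S^-1] times cell [j], a quarter turn
    of the positive part. *)
Lemma cusp_orbit_Tinv_pos x y : cusp x y -> cusp_orbit (x - lam q * y) y.
Proof.
intros Hc. destruct Hc as [| |j x y Hj Hc].
- left. rewrite Rmult_0_r, Rminus_0_r. apply cusp_e1.
- right; right; right. pose proof (cusp_last_cell 1 0 cusp_e1) as Hl.
  replace (- (0 - lam q * 1)) with (lam q * 1 + 0) by ring. exact Hl.
- simpl. destruct j as [|j].
  + left. rewrite rung_rec, rung_1, rung_0.
    cusp_ring Hc.
  + right; right; right. pose proof (cusp_cell j x y ltac:(lia) Hc) as Hl. simpl in Hl.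
    match goal with |- cusp _ ?b => replace b with (sg j * x + sg (S j) * y)
      by (rewrite (rung_rec (S j)), (rung_rec j); ring) end. exact Hl.
Qed.

Lemma cusp_orbit_T x y : cusp_orbit x y -> cusp_orbit (x + lam q * y) y.
Proof.
intros [Hc|[Hc|[Hc|Hc]]].
- left. apply cusp_first_cell, Hc.
- apply cusp_orbit_opp. left. apply cusp_first_cell in Hc.
  replace (- (x + lam q * y)) with (- x + lam q * - y) by ring. exact Hc.
- apply cusp_orbit_TS in Hc. rewrite Ropp_involutive in Hc.
  replace (x + lam q * y) with (x - lam q * - y) by ring. exact Hc.
- apply cusp_orbit_opp. apply cusp_orbit_TS in Hc.
  replace (- (x + lam q * y)) with (- x - lam q * y) by ring. exact Hc.
Qed.

Lemma cusp_orbit_Tinv x y : cusp_orbit x y -> cusp_orbit (x - lam q * y) y.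
Proof.
intros [Hc|[Hc|[Hc|Hc]]].
- apply cusp_orbit_Tinv_pos, Hc.
- apply cusp_orbit_opp. apply cusp_orbit_Tinv_pos in Hc.
  replace (- (x - lam q * y)) with (- x - lam q * - y) by ring. exact Hc.
- right; right; left. apply cusp_last_cell in Hc.
  replace (x - lam q * y) with (lam q * - y + x) by ring. exact Hc.
- right; right; right. apply cusp_last_cell in Hc.
  replace (- (x - lam q * y)) with (lam q * y + - x) by ring. exact Hc.
Qed.

Lemma hecke_cusp_orbit M : hecke q M -> cusp_orbit (m11 M) (m21 M).
Proof.
induction 1 as [|M _ IH|M _ IH|M _ IH]; simpl.
- left. apply cusp_e1.
- apply cusp_orbit_T in IH. rewrite Rmult_0_l, Rplus_0_l, !Rmult_1_l. exact IH.
- apply cusp_orbit_Tinv in IH. rewrite Rmult_0_l, Rplus_0_l, !Rmult_1_l.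
  replace (m11 M + - lam q * m21 M) with (m11 M - lam q * m21 M) by ring. exact IH.
- apply cusp_orbit_S in IH.
  replace (0 * m11 M + 1 * m21 M) with (m21 M) by ring.
  replace (-1 * m11 M + 0 * m21 M) with (- m11 M) by ring. exact IH.
Qed.

(** A determinant 1 alone would allow a diagonal [(c, 1/c)]; but the first column is an orbit vector
    on an axis, hence a unit vector. *)
Lemma hecke_parabolic M : hecke q M -> m21 M = 0 -> 0 < m11 M -> m11 M = 1.
Proof.
intros HM E Hp. destruct (hecke_cusp_orbit M HM) as [Hc|[Hc|[Hc|Hc]]].
- apply (cusp_axes _ _ Hc), E.
- pose proof (cusp_ge0 _ _ Hc). lra.
- apply (cusp_axes _ _ Hc). lra.
- pose proof (cusp_ge0 _ _ Hc). lra.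
Qed.

Lemma reduced_unique r s v w : reduced q r s -> reduced q v w -> 0 < s -> 0 < w ->
  r / s = v / w -> r = v /\ s = w.
Proof.
intros Hrs Hvw Hs Hw E.
apply reduced_hecke in Hrs. destruct Hrs as (M & HM & Er & Es).
apply reduced_hecke in Hvw. destruct Hvw as (N & HN & Ev & Ew).
pose proof (hecke_det q M HM) as D. unfold mdet in D. rewrite Er, Es in D.
assert (E' : r * w = v * s).
{ apply (Rmult_eq_compat_r (s * w)) in E.
  replace (r / s * (s * w)) with (r * w) in E by (field; lra).
  replace (v / w * (s * w)) with (v * s) in E by (field; lra). exact E. }
(* The upper left entry of [M^-1 N], an upper triangular element since both columns have the same
   ratio. *)
set (c := m22 M * v - m12 M * w).
assert (Ec : v = r * c /\ w = s * c).
{ split.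
  - rewrite <- (Rmult_1_r v), <- D. unfold c.
    replace (v * (r * m22 M - m12 M * s)) with (v * r * m22 M - m12 M * (v * s)) by ring.
    rewrite <- E'. ring.
  - rewrite <- (Rmult_1_r w), <- D. unfold c.
    replace (w * (r * m22 M - m12 M * s)) with ((r * w) * m22 M - m12 M * (w * s)) by ring.
    rewrite E'. ring. }
assert (Hc : 0 < c) by (apply (Rmult_lt_reg_l s); [lra|]; lra).
assert (C1 : c = 1).
{ pose proof (hecke_parabolic (mmul (madj M) N)) as Hpar. simpl in Hpar.
  rewrite Er, Es, Ev, Ew in Hpar.
  replace (m22 M * v + - m12 M * w) with c in Hpar by (unfold c; ring).
  apply Hpar; [apply hecke_mul; [apply hecke_adj, HM|exact HN]|lra|exact Hc]. }
rewrite C1 in Ec. lra.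
Qed.

End Group.

(** * Preimages of a fraction *)

(** Indices up to [m + 1] stay in the increasing half of the sine, and the reflection [j -> q - j]
    exchanges [m + 1] and [m + 2]; this is where oddness enters. *)
Lemma rung_ladder q m : q = (2 * m + 3)%nat -> ladder (lam q) (rung q) m.
Proof.
intros Eq. assert (q3 : (3 <= q)%nat) by lia.
pose proof (INR_q_pos q q3) as Hq. pose proof PI_RGT_0 as Hpi.
assert (Ht : 0 < PI / INR q <= PI / 3).
{ split; [apply Rdiv_lt_0_compat; lra|]. apply Rmult_le_compat_l; [lra|].
  apply Rinv_le_contravar; lra. }
split.
- unfold lam. split.
  + pose proof (cos_decr_1 (PI / INR q) (PI / 3) ltac:(lra) ltac:(lra) ltac:(lra) ltac:(lra)
      ltac:(lra)) as Hc.
    rewrite cos_PI3 in Hc. lra.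
  + pose proof (cos_decreasing_1 0 (PI / INR q) ltac:(lra) ltac:(lra) ltac:(lra) ltac:(lra)
      ltac:(lra)) as Hc.
    rewrite cos_0 in Hc. lra.
- apply rung_0.
- apply rung_1, q3.
- intros i. apply rung_rec, q3.
- intros i Hi. unfold rung, sq. apply Rmult_le_compat_r.
  + apply Rlt_le, Rinv_0_lt_compat, sin_q1_pos, q3.
  + assert (Hi1 : INR (S i) * 2 <= INR q)
      by (change 2 with (INR 2); rewrite <- mult_INR; apply le_INR; lia).
    rewrite S_INR in *. pose proof (pos_INR i).
    assert (A1 : (INR i + 1) * PI / INR q <= PI / 2).
    { apply Rle_div_l_intro; [lra|]. nra. }
    assert (A0 : 0 <= INR i * PI / INR q) by (apply Rdiv_le_0_compat; nra).
    assert (A2 : INR i * PI / INR q <= (INR i + 1) * PI / INR q).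
    { apply Rmult_le_compat_r; [apply Rlt_le, Rinv_0_lt_compat; lra|]. nra. }
    apply sin_incr_1; lra.
- rewrite <- (rung_reflect q q3 (S m)) by lia. f_equal. lia.
Qed.

Definition sum_at (f : R -> R) (l : list (R * R)) : R :=
  sum_list (map (fun p => f (fst p / snd p) / snd p ^ 2) l).

Lemma sum_list_app l l' : sum_list (l ++ l') = sum_list l + sum_list l'.
Proof. induction l as [|x l IH]; simpl; [ring|rewrite IH; ring]. Qed.

Lemma sum_list_seq (F : nat -> R) n : sum_list (map F (seq 0 (S n))) = sum_f_R0 F n.
Proof.
induction n as [|n IH]; [simpl; ring|].
rewrite seq_S, map_app, sum_list_app, IH. simpl. ring.
Qed.

Lemma NoDup_flat_map {A B : Type} (F : A -> list B) l :
  NoDup l -> (forall x, In x l -> NoDup (F x)) ->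
  (forall x y b, In x l -> In y l -> In b (F x) -> In b (F y) -> x = y) ->
  NoDup (flat_map F l).
Proof.
induction 1 as [|x l Hx _ IH]; intros H1 H2; simpl; [constructor|].
apply NoDup_app.
- apply H1. left. reflexivity.
- apply IH; [intros; apply H1; right; assumption|].
  intros y z b Hy Hz. apply H2; right; assumption.
- intros b Hb Hb'. apply in_flat_map in Hb'. destruct Hb' as (y & Hy & Hby).
  apply Hx. rewrite (H2 x y b); auto with datatypes.
Qed.

(* The inverse branches on fractions, as linear maps of (numerator, denominator). *)
Definition lift_l (sg : nat -> R) i (p : R * R) : R * R :=
  (sg (S i) * fst p + sg i * snd p, sg (S (S i)) * fst p + sg (S i) * snd p).
Definition lift_r (sg : nat -> R) i (p : R * R) : R * R := lift_l sg i (snd p, fst p).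

Definition unlift_l (sg : nat -> R) i (p : R * R) : R * R :=
  (sg (S i) * fst p - sg i * snd p, sg (S i) * snd p - sg (S (S i)) * fst p).

(* At ratio 1 the two families of preimages coincide. *)
Definition preimages (sg : nat -> R) (m : nat) (p : R * R) : list (R * R) :=
  map (fun i => lift_l sg i p) (seq 0 (S m)) ++
  (if Req_EM_T (fst p) (snd p) then nil else map (fun i => lift_r sg i p) (seq 0 (S m))).

Fixpoint preimages_iter (sg : nat -> R) (m : nat) n (p : R * R) : list (R * R) :=
  match n with
  | O => p :: nil
  | S n => flat_map (preimages sg m) (preimages_iter sg m n p)
  end.

Definition in_unit (p : R * R) := 0 < snd p /\ 0 < fst p / snd p <= 1.
Definition in_open_unit (p : R * R) := 0 < snd p /\ 0 < fst p / snd p < 1.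

(** Common image of 1 under [zl i] and [zr i], where the two halves of a cell meet. *)
Definition mid (sg : nat -> R) i := (sg (S i) + sg i) / (sg (S (S i)) + sg (S i)).

Section Preimages.

Context {la : R} {sg : nat -> R} {m : nat} (H : ladder la sg m).

Lemma unlift_lift i p : unlift_l sg i (lift_l sg i p) = p.
Proof.
pose proof (ladder_det H i) as D. destruct p as [r s]. unfold unlift_l, lift_l. simpl fst. simpl snd.
apply injective_projections; simpl.
- transitivity ((sg (S i) ^ 2 - sg i * sg (S (S i))) * r); [ring|rewrite D; ring].
- transitivity ((sg (S i) ^ 2 - sg i * sg (S (S i))) * s); [ring|rewrite D; ring].
Qed.

Lemma lift_unlift i p : lift_l sg i (unlift_l sg i p) = p.
Proof.
pose proof (ladder_det H i) as D. destruct p as [r s]. unfold unlift_l, lift_l. simpl fst. simpl snd.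
apply injective_projections; simpl.
- transitivity ((sg (S i) ^ 2 - sg i * sg (S (S i))) * r); [ring|rewrite D; ring].
- transitivity ((sg (S i) ^ 2 - sg i * sg (S (S i))) * s); [ring|rewrite D; ring].
Qed.

Lemma open_unit_unit p : in_open_unit p -> in_unit p.
Proof. unfold in_unit, in_open_unit. intros. lra. Qed.

Lemma lift_l_ratio i p : (i <= m)%nat -> in_unit p ->
  snd (lift_l sg i p) = snd p * dl sg i (fst p / snd p) /\
  fst (lift_l sg i p) / snd (lift_l sg i p) = zl sg i (fst p / snd p).
Proof.
intros Hi [Hs Hr]. pose proof (dl_pos H i _ Hi ltac:(apply Rlt_le, Hr)) as D.
assert (E : snd (lift_l sg i p) = snd p * dl sg i (fst p / snd p)).
{ unfold dl. simpl. field. lra. }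
split; [exact E|]. rewrite E. unfold zl. simpl. field. lra.
Qed.

Lemma lift_r_ratio i p : (i <= m)%nat -> in_unit p ->
  snd (lift_r sg i p) = snd p * dr sg i (fst p / snd p) /\
  fst (lift_r sg i p) / snd (lift_r sg i p) = zr sg i (fst p / snd p).
Proof.
intros Hi [Hs Hr]. pose proof (dr_pos H i _ Hi ltac:(apply Rlt_le, Hr)) as D.
assert (E : snd (lift_r sg i p) = snd p * dr sg i (fst p / snd p)).
{ unfold dr. simpl. field. lra. }
split; [exact E|]. rewrite E. unfold zr. simpl. field. lra.
Qed.

Lemma ladder_lt i : (i <= m)%nat -> sg i < sg (S i).
Proof.
intros Hi. pose proof (ladder_step H i Hi). pose proof (ladder_det H i).
destruct (Rle_lt_or_eq_dec (sg i) (sg (S i))) as [Hl|He]; [lra|exact Hl|exfalso; nra].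
Qed.

(** The distances to the two ends are written as fractions with the determinant as a factor of the
    numerator, which makes their signs visible. *)
Lemma zl_cell i y : (i <= m)%nat -> 0 < y <= 1 -> sg i / sg (S i) < zl sg i y <= mid sg i.
Proof.
intros Hi Hy. pose proof (ladder_step H i Hi). pose proof (ladder_det H i) as D.
pose proof (dl_pos H i y Hi ltac:(lra)).
replace (sg i / sg (S i)) with (zl sg i y - y * (sg (S i) ^ 2 - sg i * sg (S (S i))) / (sg (S i) * dl sg i y))
  by (unfold zl, dl in *; field; lra).
replace (mid sg i) with (zl sg i y + (1 - y) * (sg (S i) ^ 2 - sg i * sg (S (S i))) / ((sg (S (S i)) + sg (S i)) * dl sg i y))
  by (unfold zl, mid, dl in *; field; lra).
rewrite D. split.
- assert (0 < y * 1 / (sg (S i) * dl sg i y)) by (apply Rdiv_lt_0_compat; nra). lra.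
- assert (0 <= (1 - y) * 1 / ((sg (S (S i)) + sg (S i)) * dl sg i y)).
  { apply Rdiv_le_0_compat; [lra|]. apply Rmult_lt_0_compat; lra. } lra.
Qed.

Lemma zr_cell i y : (i <= m)%nat -> 0 < y <= 1 ->
  mid sg i <= zr sg i y < sg (S i) / sg (S (S i)) /\ (y < 1 -> mid sg i < zr sg i y).
Proof.
intros Hi Hy. pose proof (ladder_step H i Hi). pose proof (ladder_det H i) as D.
pose proof (dr_pos H i y Hi ltac:(lra)).
replace (sg (S i) / sg (S (S i))) with (zr sg i y + y * (sg (S i) ^ 2 - sg i * sg (S (S i))) / (sg (S (S i)) * dr sg i y))
  by (unfold zr, dr in *; field; lra).
replace (mid sg i) with (zr sg i y - (1 - y) * (sg (S i) ^ 2 - sg i * sg (S (S i))) / ((sg (S (S i)) + sg (S i)) * dr sg i y))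
  by (unfold zr, mid, dr in *; field; lra).
rewrite D.
assert (0 < (sg (S (S i)) + sg (S i)) * dr sg i y) by (apply Rmult_lt_0_compat; lra).
split; [split|].
- assert (0 <= (1 - y) * 1 / ((sg (S (S i)) + sg (S i)) * dr sg i y)) by (apply Rdiv_le_0_compat; lra).
  lra.
- assert (0 < y * 1 / (sg (S (S i)) * dr sg i y)) by (apply Rdiv_lt_0_compat; nra). lra.
- intros Hy1.
  assert (0 < (1 - y) * 1 / ((sg (S (S i)) + sg (S i)) * dr sg i y)) by (apply Rdiv_lt_0_compat; lra).
  lra.
Qed.

Lemma zl_lt_1 i y : (i <= m)%nat -> 0 < y <= 1 -> zl sg i y < 1.
Proof.
intros Hi Hy. pose proof (ladder_step H i Hi). pose proof (ladder_lt i Hi).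
pose proof (dl_pos H i y Hi ltac:(lra)). unfold zl.
apply (Rmult_lt_reg_r (dl sg i y)); [assumption|].
unfold Rdiv. rewrite Rmult_assoc, Rinv_l by lra. unfold dl. nra.
Qed.

Lemma zr_lt_1 i y : (i <= m)%nat -> 0 < y <= 1 -> zr sg i y < 1.
Proof.
intros Hi Hy. pose proof (ladder_step H i Hi). pose proof (ladder_lt i Hi).
pose proof (dr_pos H i y Hi ltac:(lra)). unfold zr.
apply (Rmult_lt_reg_r (dr sg i y)); [assumption|].
unfold Rdiv. rewrite Rmult_assoc, Rinv_l by lra. unfold dr. nra.
Qed.

Lemma in_preimages p b : In b (preimages sg m p) <->
  exists i, (i <= m)%nat /\ (b = lift_l sg i p \/ (fst p <> snd p /\ b = lift_r sg i p)).
Proof.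
unfold preimages. rewrite in_app_iff, in_map_iff. split.
- intros [(i & <- & Hi)|Hb].
  + apply in_seq in Hi. exists i. split; [lia|auto].
  + destruct (Req_EM_T (fst p) (snd p)) as [E|E]; [destruct Hb|].
    apply in_map_iff in Hb. destruct Hb as (i & <- & Hi).
    apply in_seq in Hi. exists i. split; [lia|auto].
- intros (i & Hi & [->|[E ->]]).
  + left. exists i. split; [reflexivity|]. apply in_seq. lia.
  + right. destruct (Req_EM_T (fst p) (snd p)); [contradiction|].
    apply in_map_iff. exists i. split; [reflexivity|]. apply in_seq. lia.
Qed.

Lemma preimages_open_unit p b : in_unit p -> In b (preimages sg m p) -> in_open_unit b.
Proof.
intros Hp Hb. apply in_preimages in Hb. destruct Hb as (i & Hi & Hb).
assert (Hy : 0 < fst p / snd p <= 1) by apply Hp. unfold in_open_unit.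
destruct Hb as [->|[_ ->]].
- destruct (lift_l_ratio i p Hi Hp) as [-> ->].
  pose proof (zl_pos H i _ Hi Hy). pose proof (zl_lt_1 i _ Hi Hy).
  pose proof (dl_pos H i _ Hi ltac:(apply Rlt_le, Hy)). destruct Hp. split; [nra|lra].
- destruct (lift_r_ratio i p Hi Hp) as [-> ->].
  pose proof (zr_bounds H i (fst p / snd p) Hi ltac:(lra)). pose proof (zr_lt_1 i _ Hi Hy).
  pose proof (dr_pos H i _ Hi ltac:(apply Rlt_le, Hy)). destruct Hp. split; [nra|lra].
Qed.

Lemma preimages_iter_unit n p b : in_unit p -> In b (preimages_iter sg m n p) -> in_unit b.
Proof.
intros Hp. revert b. induction n as [|n IH]; simpl; intros b Hb.
- destruct Hb as [<-|[]]. exact Hp.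
- apply in_flat_map in Hb. destruct Hb as (c & Hc & Hb).
  apply open_unit_unit, (preimages_open_unit c); auto.
Qed.

Lemma preimages_iter_open_unit n p b : in_unit p -> In b (preimages_iter sg m (S n) p) -> in_open_unit b.
Proof.
intros Hp Hb. simpl in Hb. apply in_flat_map in Hb. destruct Hb as (c & Hc & Hb).
apply (preimages_open_unit c); [|exact Hb]. apply (preimages_iter_unit n p); assumption.
Qed.

Lemma ladder_ratio_le i j : (S i <= j)%nat -> (j <= m)%nat -> sg (S i) / sg (S (S i)) <= sg j / sg (S j).
Proof.
induction 1 as [|j Hj IH]; intros Hm; [lra|].
transitivity (sg j / sg (S j)); [apply IH; lia|].
pose proof (ladder_step H j ltac:(lia)). pose proof (ladder_det H j).
pose proof (ladder_step H (S j) ltac:(lia)).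
apply Rdiv_le_cross; [lra|lra|]. nra.
Qed.

Lemma preimage_location p b i : (i <= m)%nat -> in_unit p ->
  (b = lift_l sg i p -> sg i / sg (S i) < fst b / snd b < sg (S i) / sg (S (S i)) /\ fst b / snd b <= mid sg i) /\
  (b = lift_r sg i p -> sg i / sg (S i) < fst b / snd b < sg (S i) / sg (S (S i)) /\
     (fst p <> snd p -> mid sg i < fst b / snd b)).
Proof.
intros Hi Hp. assert (Hy : 0 < fst p / snd p <= 1) by apply Hp.
pose proof (zl_cell i _ Hi Hy) as Zl. pose proof (zr_cell i _ Hi Hy) as Zr.
split; intros ->.
- destruct (lift_l_ratio i p Hi Hp) as [_ ->]. lra.
- destruct (lift_r_ratio i p Hi Hp) as [_ ->]. split; [lra|].
  intros Hne. apply Zr. destruct (proj2 Hy) as [Hlt|Heq]; [exact Hlt|].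
  exfalso. apply Hne. destruct Hp as [Hs _].
  apply (Rmult_eq_reg_r (/ snd p)); [|apply Rinv_neq_0_compat; lra].
  rewrite Rinv_r by lra. exact Heq.
Qed.

(** The position of the ratio reveals the cell and its half; the middle counts as left, right lifts
    being listed only away from ratio 1. On each half the lift is injective. *)
Lemma preimages_determined p p' b i i' :
  (i <= m)%nat -> (i' <= m)%nat -> in_unit p -> in_unit p' ->
  (b = lift_l sg i p \/ fst p <> snd p /\ b = lift_r sg i p) ->
  (b = lift_l sg i' p' \/ fst p' <> snd p' /\ b = lift_r sg i' p') ->
  i = i' /\ p = p' /\ (b = lift_l sg i p -> b = lift_l sg i' p').
Proof.
intros Hi Hi' Hp Hp' Hb Hb'.
destruct (preimage_location p b i Hi Hp) as [Ll Lr].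
destruct (preimage_location p' b i' Hi' Hp') as [Ll' Lr'].
assert (C : sg i / sg (S i) < fst b / snd b < sg (S i) / sg (S (S i)))
  by (destruct Hb as [Hb|[_ Hb]]; [apply Ll|apply Lr]; exact Hb).
assert (C' : sg i' / sg (S i') < fst b / snd b < sg (S i') / sg (S (S i')))
  by (destruct Hb' as [Hb'|[_ Hb']]; [apply Ll'|apply Lr']; exact Hb').
assert (Ei : i = i').
{ destruct (Nat.lt_trichotomy i i') as [Hlt|[He|Hlt]]; [exfalso|exact He|exfalso].
  - pose proof (ladder_ratio_le i i' Hlt Hi'). lra.
  - pose proof (ladder_ratio_le i' i Hlt Hi). lra. }
subst i'. split; [reflexivity|].
assert (Hinj : forall a a', lift_l sg i a = lift_l sg i a' -> a = a').
{ intros a a' E. rewrite <- (unlift_lift i a), E. apply unlift_lift. }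
destruct Hb as [Hb|[Hn Hb]], Hb' as [Hb'|[Hn' Hb']].
- split; [|tauto]. apply Hinj. congruence.
- exfalso. specialize (Ll Hb). specialize (Lr' Hb'). destruct Lr' as [_ Lr']. specialize (Lr' Hn'). lra.
- exfalso. specialize (Ll' Hb'). specialize (Lr Hb). destruct Lr as [_ Lr]. specialize (Lr Hn). lra.
- assert (E : p = p').
  { unfold lift_r in *. assert (E : (snd p, fst p) = (snd p', fst p')) by (apply Hinj; congruence).
    injection E as E1 E2. destruct p, p'. simpl in *. congruence. }
  split; [exact E|]. subst p'. tauto.
Qed.

Lemma preimages_NoDup p : in_unit p -> NoDup (preimages sg m p).
Proof.
intros Hp. unfold preimages. apply NoDup_app.
- apply NoDup_map_NoDup_ForallPairs; [|apply seq_NoDup].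
  intros i j Hi Hj E. apply in_seq in Hi. apply in_seq in Hj.
  apply (preimages_determined p p (lift_l sg i p) i j); try lia; auto.
- destruct (Req_EM_T (fst p) (snd p)) as [E|E]; [constructor|].
  apply NoDup_map_NoDup_ForallPairs; [|apply seq_NoDup].
  intros i j Hi Hj E'. apply in_seq in Hi. apply in_seq in Hj.
  apply (preimages_determined p p (lift_r sg i p) i j); try lia; auto.
- intros b Hb Hb'. destruct (Req_EM_T (fst p) (snd p)) as [E|E]; [destruct Hb'|].
  apply in_map_iff in Hb. destruct Hb as (i & Eb & Hi). apply in_seq in Hi.
  apply in_map_iff in Hb'. destruct Hb' as (j & Eb' & Hj). apply in_seq in Hj.
  destruct (preimages_determined p p b i j ltac:(lia) ltac:(lia) Hp Hp) as (Eij & _ & _);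
    [auto|auto|]. subst j.
  pose proof (proj1 (preimage_location p b i ltac:(lia) Hp) (eq_sym Eb)) as P1.
  pose proof (proj2 (preimage_location p b i ltac:(lia) Hp) (eq_sym Eb')) as [_ P2].
  specialize (P2 E). lra.
Qed.

Lemma preimages_iter_NoDup n p : in_unit p -> NoDup (preimages_iter sg m n p).
Proof.
intros Hp. induction n as [|n IH]; simpl.
- constructor; [intros []|constructor].
- apply NoDup_flat_map; [exact IH| |].
  + intros x Hx. apply preimages_NoDup. apply (preimages_iter_unit n p); assumption.
  + intros x y b Hx Hy Hb Hb'.
    apply in_preimages in Hb. destruct Hb as (i & Hi & Hb).
    apply in_preimages in Hb'. destruct Hb' as (j & Hj & Hb').
    apply (preimages_determined x y b i j); auto; apply (preimages_iter_unit n p); assumption.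
Qed.

Lemma sum_at_lefts f p : in_unit p ->
  sum_at f (map (fun i => lift_l sg i p) (seq 0 (S m))) =
  sum_f_R0 (fun i => f (zl sg i (fst p / snd p)) / dl sg i (fst p / snd p) ^ 2) m / snd p ^ 2.
Proof.
intros Hp. unfold sum_at. rewrite map_map, sum_list_seq.
unfold Rdiv at 3. rewrite Rmult_comm, scal_sum. apply sum_eq. intros i Hi.
destruct (lift_l_ratio i p Hi Hp) as [E1 E2]. rewrite E2, E1.
pose proof (dl_pos H i _ Hi ltac:(apply Rlt_le, Hp)). destruct Hp. field. lra.
Qed.

Lemma sum_at_rights f p : in_unit p ->
  sum_at f (map (fun i => lift_r sg i p) (seq 0 (S m))) =
  sum_f_R0 (fun i => f (zr sg i (fst p / snd p)) / dr sg i (fst p / snd p) ^ 2) m / snd p ^ 2.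
Proof.
intros Hp. unfold sum_at. rewrite map_map, sum_list_seq.
unfold Rdiv at 3. rewrite Rmult_comm, scal_sum. apply sum_eq. intros i Hi.
destruct (lift_r_ratio i p Hi Hp) as [E1 E2]. rewrite E2, E1.
pose proof (dr_pos H i _ Hi ltac:(apply Rlt_le, Hp)). destruct Hp. field. lra.
Qed.

Lemma sum_at_app f l l' : sum_at f (l ++ l') = sum_at f l + sum_at f l'.
Proof. unfold sum_at. rewrite map_app. apply sum_list_app. Qed.

(** At ratio 1 the list carries only the left half of the operator sum, and the right half is equal
    to it: hence the factor 2 of [cconst]. *)
Lemma sum_at_preimages f p : in_unit p ->
  cconst (fst p / snd p) * sum_at f (preimages sg m p) = transfer sg m f (fst p / snd p) / snd p ^ 2.
Proof.
intros Hp. assert (Hs : 0 < snd p) by apply Hp. unfold preimages, transfer.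
rewrite sum_at_app, sum_at_lefts, sum_plus by exact Hp.
unfold cconst. destruct (Req_EM_T (fst p) (snd p)) as [E|E], (Req_EM_T (fst p / snd p) 1) as [E'|E'].
- rewrite E'. rewrite (sum_eq (fun i => f (zr sg i 1) / dr sg i 1 ^ 2) (fun i => f (zl sg i 1) / dl sg i 1 ^ 2)).
  + unfold sum_at. simpl sum_list. field. lra.
  + intros i _. assert (Ed : dr sg i 1 = dl sg i 1) by (unfold dl, dr; ring).
    unfold zl, zr. rewrite Ed. do 3 f_equal. ring.
- exfalso. apply E'. rewrite E. field. lra.
- exfalso. apply E. apply (Rmult_eq_reg_r (/ snd p)); [|apply Rinv_neq_0_compat; lra].
  rewrite Rinv_r by lra. exact E'.
- rewrite sum_at_rights by exact Hp. field. lra.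
Qed.

Lemma sum_at_flat_map f l : (forall p, In p l -> in_open_unit p) ->
  sum_at f (flat_map (preimages sg m) l) = sum_at (transfer sg m f) l.
Proof.
induction l as [|p l IH]; intros Hl; [reflexivity|].
change (sum_at f (preimages sg m p ++ flat_map (preimages sg m) l) =
  transfer sg m f (fst p / snd p) / snd p ^ 2 + sum_at (transfer sg m f) l).
rewrite sum_at_app, IH by (intros; apply Hl; right; assumption).
pose proof (Hl p (or_introl eq_refl)) as Hp.
pose proof (sum_at_preimages f p (open_unit_unit p Hp)) as E.
unfold cconst in E. destruct (Req_EM_T (fst p / snd p) 1) as [E1|_].
- destruct Hp. lra.
- rewrite Rmult_1_l in E. rewrite E. reflexivity.
Qed.

(** Proper preimages have ratio below 1, so [cconst] acts in the first step alone. At index 0 there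
    is no doubling for it to account for, hence [S n]. *)
Lemma sum_at_preimages_iter f n p : in_unit p ->
  cconst (fst p / snd p) * sum_at f (preimages_iter sg m (S n) p) =
  transfer_iter sg m f (S n) (fst p / snd p) / snd p ^ 2.
Proof.
intros Hp. revert f. induction n as [|n IH]; intros f.
- simpl preimages_iter. rewrite app_nil_r. apply sum_at_preimages, Hp.
- change (preimages_iter sg m (S (S n)) p) with (flat_map (preimages sg m) (preimages_iter sg m (S n) p)).
  rewrite sum_at_flat_map by (intros b; apply preimages_iter_open_unit, Hp).
  rewrite IH. unfold transfer_iter. rewrite (Nat.iter_succ_r (S n)). reflexivity.
Qed.

End Preimages.

(** * Equidistribution *)

Section FareyPreimages.

Context (q m : nat) (Eq : q = (2 * m + 3)%nat).

Local Notation sg := (rung q).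

Let q3 : (3 <= q)%nat. Proof. lia. Qed.
Let H : ladder (lam q) sg m := rung_ladder q m Eq.

Lemma gk_rung i : (i <= m)%nat ->
  gk q (q - S i) = Mat (sg (S i)) (- sg i) (- sg (S (S i))) (sg (S i)).
Proof.
intros Hi. unfold gk.
replace (INR (q - S i) + 1) with (INR (q - i))
  by (rewrite <- S_INR; f_equal; lia).
replace (INR (q - S i) - 1) with (INR (q - S (S i)))
  by (replace (q - S i)%nat with (S (q - S (S i))) by lia; rewrite S_INR; ring).
fold (rung q (q - S i)) (rung q (q - i)) (rung q (q - S (S i))).
rewrite !(rung_reflect q q3) by lia. reflexivity.
Qed.

Lemma inK_rung k : inK q k <-> exists i, (i <= m)%nat /\ k = (q - S i)%nat.
Proof.
unfold inK. replace (q + 1)%nat with ((m + 2) * 2)%nat by lia. rewrite Nat.div_mul by lia.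
split.
- intros Hk. exists (q - 1 - k)%nat. lia.
- intros (i & Hi & ->). lia.
Qed.

(** Identifies the matrix of [lift_l], the adjugate of [g_k], with a cell of reversed index, so that
    lifts preserve reduced fractions. *)
Lemma cell_rung i : (i <= m)%nat ->
  cell q (q - S (S i)) = Mat (sg (S i)) (sg i) (sg (S (S i))) (sg (S i)).
Proof.
intros Hi. unfold cell.
replace (S (q - S (S i))) with (q - S i)%nat by lia. replace (S (q - S i)) with (q - i)%nat by lia.
rewrite !(rung_reflect q q3) by lia. reflexivity.
Qed.

Lemma reduced_lift_l i p : (i <= m)%nat -> reduced q (fst p) (snd p) ->
  reduced q (fst (lift_l sg i p)) (snd (lift_l sg i p)).
Proof.
intros Hi Hp. pose proof (reduced_act q _ _ _ (hecke_cell q q3 (q - S (S i))) Hp) as Hr.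
rewrite cell_rung in Hr by exact Hi. exact Hr.
Qed.

Lemma reduced_unlift_l i p : (i <= m)%nat -> reduced q (fst p) (snd p) ->
  reduced q (fst (unlift_l sg i p)) (snd (unlift_l sg i p)).
Proof.
intros Hi Hp.
pose proof (reduced_act q _ _ _ (hecke_adj q _ (hecke_cell q q3 (q - S (S i)))) Hp) as Hr.
rewrite cell_rung in Hr by exact Hi. simpl in Hr. unfold unlift_l. simpl.
replace (sg (S i) * fst p - sg i * snd p) with (sg (S i) * fst p + - sg i * snd p) by ring.
replace (sg (S i) * snd p - sg (S (S i)) * fst p)
  with (- sg (S (S i)) * fst p + sg (S i) * snd p) by ring.
exact Hr.
Qed.

Lemma reduced_preimages p b : reduced q (fst p) (snd p) -> In b (preimages sg m p) ->
  reduced q (fst b) (snd b).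
Proof.
intros Hp Hb. apply in_preimages in Hb. destruct Hb as (i & Hi & [->|[_ ->]]).
- apply reduced_lift_l; assumption.
- apply reduced_lift_l; [assumption|]. apply reduced_swap. exact Hp.
Qed.

Lemma farey_cell_ends i : (i <= m)%nat ->
  mob (madj (gk q (q - S i))) 0 = sg i / sg (S i) /\
  mob (madj (gk q (q - S i))) 1 = mid sg i /\
  mob (madj (mmul matQ (gk q (q - S i)))) 1 = mid sg i /\
  mob (madj (mmul matQ (gk q (q - S i)))) 0 = sg (S i) / sg (S (S i)).
Proof.
intros Hi. pose proof (ladder_step H i Hi). rewrite gk_rung by exact Hi.
unfold mob, mid. simpl. repeat split; field; lra.
Qed.

Lemma Frel_preimages p b : in_unit p -> In b (preimages sg m p) ->
  Frel q (fst b / snd b) (fst p / snd p).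
Proof.
intros Hp Hb. destruct (preimages_open_unit H p b Hp Hb) as [_ Hb1]. split; [lra|].
assert (Hy : 0 < fst p / snd p <= 1) by apply Hp.
apply in_preimages in Hb. destruct Hb as (i & Hi & Hb). exists (q - S i)%nat.
split; [apply inK_rung; exists i; auto|].
destruct (farey_cell_ends i Hi) as (E1 & E2 & E3 & E4). rewrite E1, E2, E3, E4.
pose proof (ladder_step H i Hi) as Hs. pose proof (ladder_det H i) as D.
destruct Hb as [->|[_ ->]]; [left|right].
- destruct (lift_l_ratio H i p Hi Hp) as [_ ->]. pose proof (zl_cell H i _ Hi Hy).
  split; [lra|]. rewrite gk_rung by exact Hi. set (y := fst p / snd p) in *.
  pose proof (dl_pos H i y Hi ltac:(lra)).
  unfold mob. simpl m11. simpl m12. simpl m21. simpl m22.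
  replace (- sg (S (S i)) * zl sg i y + sg (S i)) with
    ((sg (S i) ^ 2 - sg i * sg (S (S i))) / dl sg i y) by (unfold zl, dl in *; field; lra).
  replace (sg (S i) * zl sg i y + - sg i) with
    ((sg (S i) ^ 2 - sg i * sg (S (S i))) * y / dl sg i y) by (unfold zl, dl in *; field; lra).
  rewrite D. field. lra.
- destruct (lift_r_ratio H i p Hi Hp) as [_ ->]. pose proof (zr_cell H i _ Hi Hy).
  split; [lra|]. rewrite gk_rung by exact Hi. set (y := fst p / snd p) in *.
  pose proof (dr_pos H i y Hi ltac:(lra)).
  unfold mob. simpl.
  replace (_ + _) with
    ((sg (S i) ^ 2 - sg i * sg (S (S i))) * y / dr sg i y) at 1 by (unfold zr, dr in *; field; lra).
  replace ((1 * sg (S i) + 0 * - sg (S (S i))) * zr sg i y + (1 * - sg i + 0 * sg (S i))) with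
    ((sg (S i) ^ 2 - sg i * sg (S (S i))) / dr sg i y) by (unfold zr, dr in *; field; lra).
  rewrite D. field. lra.
Qed.

Lemma Frel_inv b z : reduced q (fst b) (snd b) -> 0 < snd b -> Frel q (fst b / snd b) z ->
  exists p, reduced q (fst p) (snd p) /\ 0 < snd p /\ fst p / snd p = z /\
    In b (preimages sg m p).
Proof.
intros Hb Hs [_ (k & Hk & HF)]. apply inK_rung in Hk. destruct Hk as (i & Hi & ->).
destruct (farey_cell_ends i Hi) as (E1 & E2 & E3 & E4). rewrite E1, E2, E3, E4 in HF.
rewrite gk_rung in HF by exact Hi.
pose proof (ladder_step H i Hi) as Hst. pose proof (ladder_det H i) as D.
assert (Hu : reduced q (fst (unlift_l sg i b)) (snd (unlift_l sg i b)))
  by (apply reduced_unlift_l; assumption).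
set (x := fst b / snd b) in *. assert (Eb : fst b = x * snd b) by (unfold x; field; lra).
destruct HF as [[Hx ->]|[Hx ->]].
- exists (unlift_l sg i b).
  (* The closed left half-cell avoids the right end of the cell, which is the pole of [g_k]. *)
  assert (Hp : 0 < sg (S i) - sg (S (S i)) * x).
  { assert (x * (sg (S (S i)) + sg (S i)) <= sg (S i) + sg i) by (apply Rle_div_r; [lra|apply Hx]).
    nra. }
  assert (Hsn : 0 < snd (unlift_l sg i b)).
  { unfold unlift_l. simpl. rewrite Eb. nra. }
  split; [exact Hu|split; [exact Hsn|split]].
  + unfold unlift_l, mob. simpl. rewrite Eb. field. repeat split; try lra.
    apply Rgt_not_eq. nra.
  + apply in_preimages. exists i. split; [exact Hi|left]. symmetry. apply (lift_unlift H).
- exists (snd (unlift_l sg i b), fst (unlift_l sg i b)).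
  (* The closed right half-cell avoids the left end of the cell, which is the pole of [Q g_k]. *)
  assert (Hp : 0 < sg (S i) * x - sg i).
  { assert (sg (S i) + sg i <= x * (sg (S (S i)) + sg (S i))) by (apply Rle_div_l; [lra|apply Hx]).
    nra. }
  assert (Hsn : 0 < fst (unlift_l sg i b)).
  { unfold unlift_l. simpl. rewrite Eb. nra. }
  split; [apply reduced_swap; exact Hu|split; [exact Hsn|split]].
  + unfold unlift_l, mob. simpl. rewrite Eb. field. repeat split; try lra.
    apply Rgt_not_eq. nra.
  + apply in_preimages. exists i. split; [exact Hi|].
    assert (El : b = lift_l sg i (unlift_l sg i b)) by (symmetry; apply (lift_unlift H)).
    destruct (unlift_l sg i b) as [u1 u2]. unfold lift_r. simpl.
    (* If the image has ratio 1, the point is the middle of the cell and is listed as a left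
       lift. *)
    destruct (Req_dec u1 u2) as [->|Hne]; [left; exact El|right]. split; [auto|exact El].
Qed.

Lemma in_preimages_iter v w n r s : reduced q v w -> 0 < w -> 0 < v / w <= 1 ->
  In (r, s) (preimages_iter sg m n (v, w)) <-> 0 < s /\ RF q n v w r s.
Proof.
intros Hvw Hw Hy. assert (Hp : in_unit (v, w)) by (split; assumption).
cut (forall b, In b (preimages_iter sg m n (v, w)) <->
  0 < snd b /\ reduced q (fst b) (snd b) /\ Fpre q n (v / w) (fst b / snd b)).
{ intros Hcut. rewrite Hcut. unfold RF. simpl. split.
  - intros (H1 & H2 & H3). repeat split; try assumption; try apply H2. lra.
  - intros (H1 & H2 & _ & H3). auto. }
clear r s. induction n as [|n IH]; intros b; simpl.
- split.
  + intros [<-|[]]. auto.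
  + intros (Hs & Hr & E). left.
    (* Equality of ratios must become equality of pairs: with positive denominators, the reduced
       fraction is unique. *)
    destruct (reduced_unique q q3 _ _ _ _ Hvw Hr Hw Hs (eq_sym E)) as [-> ->].
    destruct b. reflexivity.
- rewrite in_flat_map. split.
  + intros (p & Hpn & Hb).
    pose proof (preimages_iter_unit H n _ p Hp Hpn) as Hpu.
    destruct (proj1 (IH p) Hpn) as (Hps & Hpr & HpF).
    split; [apply (preimages_open_unit H p b Hpu Hb)|].
    split; [apply (reduced_preimages p); assumption|].
    exists (fst p / snd p). split; [apply Frel_preimages; assumption|exact HpF].
  + intros (Hs & Hr & z & HF & Hz).
    destruct (Frel_inv b z Hr Hs HF) as (p & Hpr & Hps & <- & Hb).
    exists p. split; [|exact Hb]. apply IH. auto.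
Qed.

End FareyPreimages.

(** The 1-Lipschitz retraction onto [0, 1]; composing with it makes a function continuous within
    [0, 1] continuous from both sides. *)
Definition clamp (x : R) : R := Rmax 0 (Rmin x 1).

Lemma clamp_id x : 0 <= x <= 1 -> clamp x = x.
Proof. intros Hx. unfold clamp. rewrite Rmin_left, Rmax_right; lra. Qed.

Lemma clamp_bounds x : 0 <= clamp x <= 1.
Proof. unfold clamp. apply Rmax_case_strong; apply Rmin_case_strong; lra. Qed.

Lemma cont01_clamp f : cont01 f -> continuous01 (fun x => f (clamp x)).
Proof.
intros Hf x Hx. unfold continuous. rewrite clamp_id by exact Hx.
apply (filterlim_comp _ _ _ clamp f (locally x) (within (fun y => 0 <= y <= 1) (locally x)));
  [|apply Hf, Hx].
intros P [d Hd]. exists d. intros y Hy. apply Hd; [|apply clamp_bounds].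
apply (Rle_lt_trans _ (Rabs (y - x))); [|exact Hy].
change (Rabs (clamp y - x) <= Rabs (y - x)). unfold clamp.
apply Rmax_case_strong; apply Rmin_case_strong; intros; unfold Rabs; repeat destruct Rcase_abs; lra.
Qed.

Lemma equidistribution_pos (q : nat) (v w : R) :
  (3 <= q)%nat -> Nat.Odd q -> reduced q v w -> 0 < w -> 0 < v / w <= 1 ->
  exists L : nat -> list (R * R),
    (forall n, NoDup (L n) /\
       (forall r s, In (r, s) (L n) <-> (0 < s /\ RF q n v w r s))) /\
    (forall f : R -> R, cont01 f ->
       is_lim_seq
         (fun n : nat => cconst (v / w) * v * w * ln (INR n) *
            sum_list (map (fun p => f (fst p / snd p) / (snd p) ^ 2) (L n)))
         (RInt f 0 1)).
Proof.
intros Hq [j Hj] Hvw Hw Hy.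
set (m := (j - 1)%nat). assert (Eq : q = (2 * m + 3)%nat) by (unfold m; lia).
pose proof (rung_ladder q m Eq) as H.
assert (Hp : in_unit (v, w)) by (split; assumption).
exists (fun n => preimages_iter (rung q) m n (v, w)). split.
- intros n. split; [apply (preimages_iter_NoDup H), Hp|].
  intros r s. apply in_preimages_iter; assumption.
- intros f Hf.
  destruct (equidistributes_continuous H _ (cont01_clamp f Hf)) as [_ Hlim].
  specialize (Hlim (v / w) Hy).
  replace (RInt (fun x => f (clamp x)) 0 1) with (RInt f 0 1) in Hlim.
  2: { apply RInt_ext. rewrite Rmin_left, Rmax_right by lra. intros x Hx.
       rewrite clamp_id by lra. reflexivity. }
  apply (is_lim_seq_scal_l _ (v / w)) in Hlim.
  replace (Rbar_mult (v / w) (RInt f 0 1 / (v / w))) with (Finite (RInt f 0 1)) in Hlim.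
  2: { simpl. f_equal. assert (Hc : forall a b : R, 0 < b -> a = b * (a / b)) by (intros; field; lra).
       apply Hc, Hy. }
  apply (is_lim_seq_ext_loc _ _ _) with (2 := Hlim).
  (* From [n = 1] on the two sequences agree, by [v w = (v / w) w^2]. *)
  exists 1%nat. intros n Hn. destruct n as [|n]; [lia|].
  pose proof (sum_at_preimages_iter H (fun x => f (clamp x)) n (v, w) Hp) as E.
  simpl fst in E. simpl snd in E.
  replace (transfer_iter (rung q) m (fun x => f (clamp x)) (S n) (v / w)) with
    (w ^ 2 * (cconst (v / w) * sum_at (fun x => f (clamp x)) (preimages_iter (rung q) m (S n) (v, w))))
    by (rewrite E; field; lra).
  replace (sum_at (fun x => f (clamp x)) (preimages_iter (rung q) m (S n) (v, w))) with
    (sum_list (map (fun p => f (fst p / snd p) / snd p ^ 2)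
       (preimages_iter (rung q) m (S n) (v, w)))).
  + field. lra.
  + unfold sum_at. f_equal. apply map_ext_in. intros p Hpn.
    destruct (preimages_iter_unit H (S n) _ p Hp Hpn). rewrite clamp_id by lra. reflexivity.
Qed.

Theorem theorem1p3 (q : nat) (v w : R) :
  (3 <= q)%nat -> Nat.Odd q ->
  reduced q v w -> w <> 0 -> 0 < v / w <= 1 ->
  exists L : nat -> list (R * R),
    (forall n, NoDup (L n) /\
       (forall r s, In (r, s) (L n) <-> (0 < s /\ RF q n v w r s))) /\
    (forall f : R -> R, cont01 f ->
       is_lim_seq
         (fun n : nat => cconst (v / w) * v * w * ln (INR n) *
            sum_list (map (fun p => f (fst p / snd p) / (snd p) ^ 2) (L n)))
         (RInt f 0 1)).
Proof.
intros Hq Hodd Hvw Hw Hy.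
(* The pairs [(v, w)] and [(-v, -w)] have the same ratio and the same product. *)
destruct (Rlt_le_dec 0 w) as [Hpos|Hneg]; [apply equidistribution_pos; assumption|].
assert (E : - v / - w = v / w) by (field; lra).
destruct (equidistribution_pos q (- v) (- w)) as (L & HL & Hlim);
  [assumption|assumption|apply reduced_opp, Hvw|lra|rewrite E; assumption|].
exists L. split.
- intros n. split; [apply HL|]. intros r s. rewrite (proj2 (HL n)). unfold RF. rewrite E. reflexivity.
- intros f Hf. apply (is_lim_seq_ext (fun n => cconst (- v / - w) * - v * - w * ln (INR n) *
    sum_list (map (fun p => f (fst p / snd p) / (snd p) ^ 2) (L n)))); [|apply Hlim, Hf].
  intros n. rewrite E. ring.
Qed.
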